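(* Let $D$ be a bounded domain in $\mathbb{C}^n$ and let $p\in\partial D$ be such that $\partial D$ is $\mathcal{C}^1$ near $p$. Then $$\lim_{z\to p,\ z\in D}V^S_D(z)=0.$$
   Context: For a domain $D\subset\mathbb{C}^n$, $z\in D$ and $X\in\mathbb{C}^n$, the Sibony metric is $$S_D(z;X):=\sup_v[\mathcal{L}_v(z;X)]^{1/2},$$ where $\mathcal{L}_v(z;X)=\sum_{j,k=1}^n\frac{\partial^2 v}{\partial z_j\partial\bar z_k}(z)X_j\overline{X_k}$ is the Levi form of $v$, and the supremum is taken over all functions $v:D\to[0,1)$ such that $v(z)=0$, $\log v$ is plurisubharmonic on $D$, and $v$ is of class $\mathcal{C}^2$ near $z$. $V^S_D(z)$ is the volume (Lebesgue measure in $\mathbb{C}^n\cong\mathbb{R}^{2n}$) of the indicatrix $\{X\in\mathbb{C}^n : S_D(z;X)<1\}$. ''$\partial D$ is $\mathcal{C}^1$ near $p$'' means that, in a neighborhood of $p$ and after a complex-affine unitary change of coordinates, $D$ is the set of points lying strictly on one side of the graph of a real-valued $\mathcal{C}^1$ function of the remaining $2n-1$ real variables. *)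

(* Defs.v *)
(* Over an arbitrary [R : realType], C is [R[i]] and C^n is
   ['rV[R[i]]_n], with the library's product topology and max norm. *)
From HB Require Import structures.
From mathcomp Require Import all_boot all_order all_algebra.
From mathcomp Require Import all_classical all_reals all_analysis.
From mathcomp Require Import complex spectral.
Set Implicit Arguments.
Unset Strict Implicit.
Unset Printing Implicit Defensive.
Import Order.TTheory GRing.Theory Num.Theory.
Import numFieldNormedType.Exports.

Local Open Scope classical_set_scope.
Local Open Scope ring_scope.
Local Open Scope complex_scope.

(* C carries its metric topology, as a normed space over itself. *)
HB.instance Definition _ (R : realType) := NormedModule.copy R[i] R[i]^o.

Section Differentiation.
Context {R : realType} {n : nat}.
Implicit Types (f : 'rV[R[i]]_n -> R) (g : 'rV[R[i]]_n -> R[i]).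

(* Direction of the real coordinate x_j (b = false) or y_j (b = true), where
   z_j = x_j + i y_j. *)
Definition real_dir (j : 'I_n) (b : bool) : 'rV[R[i]]_n :=
  (if b then 0 +i* 1 else 1) *: delta_mx 0 j.

(* f restricted to the real line a + R e. *)
Definition on_real_line f (e a : 'rV[R[i]]_n) : R -> R :=
  fun t => f (a + t%:C *: e).

Definition partial f (j : 'I_n) (b : bool) (a : 'rV[R[i]]_n) : R :=
  derive1 (on_real_line f (real_dir j b) a) 0.

Definition C1_on (V : set 'rV[R[i]]_n) f : Prop := forall j b,
  (forall a, V a -> derivable (on_real_line f (real_dir j b) a) 0 1) /\
  (forall a, V a -> {for a, continuous (partial f j b)}).

Definition C2_on (V : set 'rV[R[i]]_n) f : Prop :=
  C1_on V f /\ forall j b, C1_on V (partial f j b).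

Definition C2_near (z : 'rV[R[i]]_n) f : Prop :=
  exists V : set 'rV[R[i]]_n, [/\ open V, V z & C2_on V f].

Definition cpartial g (j : 'I_n) (b : bool) (a : 'rV[R[i]]_n) : R[i] :=
  partial (fun w => complex.Re (g w)) j b a +i*
  partial (fun w => complex.Im (g w)) j b a.

(* Wirtinger derivatives d/dz_j and d/d(conj z_j). *)
Definition dz (j : 'I_n) g (a : 'rV[R[i]]_n) : R[i] :=
  2^-1 * (cpartial g j false a - (0 +i* 1) * cpartial g j true a).

Definition dzbar (j : 'I_n) g (a : 'rV[R[i]]_n) : R[i] :=
  2^-1 * (cpartial g j false a + (0 +i* 1) * cpartial g j true a).

Definition levi f (z X : 'rV[R[i]]_n) : R[i] :=
  \sum_(j < n) \sum_(k < n)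
    dz j (dzbar k (fun w => (f w)%:C)) z * X 0 j * (X 0 k)^*.

End Differentiation.

Section Plurisubharmonic.
Context {R : realType} {n : nat}.
Local Open Scope ereal_scope.

(* Functions on D are total functions whose values off D are irrelevant. *)
Definition usc_on (D : set 'rV[R[i]]_n) (u : 'rV[R[i]]_n -> \bar R) : Prop :=
  forall a (r : R), D a -> u a < r%:E ->
    \forall w \near within D (nbhs a), u w < r%:E.

Definition expi (t : R) : R[i] := (cos t +i* sin t)%C.

(* u : D -> [-oo, +oo) is upper semicontinuous and has the sub-mean value
   property on every closed affine complex disc contained in D.  The constant
   -oo is allowed.  By semicontinuity u is bounded above on such a disc, so the
   integral is well defined, with value in [-oo, +oo). *)
Definition psh_on (D : set 'rV[R[i]]_n) (u : 'rV[R[i]]_n -> \bar R) : Prop :=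
  [/\ forall a, D a -> u a < +oo,
      usc_on D u
    & forall a b : 'rV[R[i]]_n,
        (forall zeta : R[i], (`|zeta| <= 1)%R -> D (a + zeta *: b)%R) ->
        u a <= ((2 * pi)^-1)%:E *
          \int[lebesgue_measure]_(t in `[0%R, (2 * pi)%R]%classic)
             u (a + expi t *: b)%R].

End Plurisubharmonic.

Section Sibony.
Context {R : realType} {n : nat}.
Implicit Types (D : set 'rV[R[i]]_n) (z X : 'rV[R[i]]_n).

(* [lne] is the logarithm on extended reals, with lne 0 = -oo. *)
Definition sibony_candidate D z (v : 'rV[R[i]]_n -> R) : Prop :=
  [/\ forall w, D w -> 0 <= v w < 1,
      v z = 0,
      psh_on D (fun w => lne (v w)%:E)
    & C2_near z v].

(* The Levi form of a real C^2 function is real, hence the use of [Re]. *)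
Definition sibony D z X : \bar R :=
  ereal_sup [set (Num.sqrt (complex.Re (levi v z X)))%:E
            | v in sibony_candidate D z].

Definition indicatrix D z : set 'rV[R[i]]_n :=
  [set X | (sibony D z X < 1)%E].

End Sibony.

Section Volume.
Context {R : realType} {n : nat}.
Implicit Types a b : 'rV[R[i]]_n.

Definition box_le a b : Prop := forall j,
  complex.Re (a 0 j) <= complex.Re (b 0 j) /\
  complex.Im (a 0 j) <= complex.Im (b 0 j).

Definition box a b : set 'rV[R[i]]_n := [set X | box_le a X /\ box_le X b].

Definition box_vol a b : R :=
  \prod_(j < n) ((complex.Re (b 0 j) - complex.Re (a 0 j)) *
                 (complex.Im (b 0 j) - complex.Im (a 0 j))).

(* Lebesgue (outer) measure on C^n = R^(2n): infimum of the total volume of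
   countable covers by closed boxes.  It is Lebesgue measure on measurable sets;
   [indicatrix D z] is Borel, [sibony D z] being a supremum of continuous
   functions of X. *)
Definition volume (A : set 'rV[R[i]]_n) : \bar R :=
  ereal_inf [set (\sum_(0 <= k <oo) (box_vol (ab.1 k) (ab.2 k))%:E)%E
            | ab in [set ab : (nat -> 'rV[R[i]]_n) * (nat -> 'rV[R[i]]_n) |
                (forall k, box_le (ab.1 k) (ab.2 k)) /\
                A `<=` \bigcup_k box (ab.1 k) (ab.2 k)]].

End Volume.

Section Main.
Context {R : realType}.

Definition sibony_volume n (D : set 'rV[R[i]]_n) (z : 'rV[R[i]]_n) : \bar R :=
  volume (indicatrix D z).

Definition domain n (D : set 'rV[R[i]]_n) : Prop :=
  [/\ open D, connected D & D !=set0].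

Definition frontier n (D : set 'rV[R[i]]_n) : set 'rV[R[i]]_n :=
  closure D `\` D°.

(* In the coordinates w = z U + b, with U unitary, D is given near p by
   Re w_0 < phi (Im w_0, w_1, ..., w_n) with phi of class C^1; [col' 0 w] is
   (w_1, ..., w_n).  Since phi viewed as a function of w does not depend on
   Re w_0, it is C^1 in w iff it is C^1 in its 2n + 1 real variables.  The
   opposite side of a graph is obtained by changing w_0 into - w_0. *)
Definition C1_boundary_near n (D : set 'rV[R[i]]_n.+1) (p : 'rV[R[i]]_n.+1) :
    Prop :=
  exists (U : 'M[R[i]]_n.+1) (b : 'rV[R[i]]_n.+1)
         (phi : R -> 'rV[R[i]]_n -> R) (V : set 'rV[R[i]]_n.+1),
    let phi_of (w : 'rV[R[i]]_n.+1) := phi (complex.Im (w 0 0)) (col' 0 w) in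
    [/\ U \is unitarymx,
        open V /\ V (p *m U + b),
        C1_on V phi_of
      & forall z, let w := z *m U + b in
          V w -> (D z <-> complex.Re (w 0 0) < phi_of w)].

End Main.

(* Main.v *)
(* Bounding the Sibony metric from below needs one good competitor v.  Near the
   boundary point, D lies in {Re l(w - z) < tau + eps |w - z|}, where eps > 0 is
   arbitrary, l is a fixed nonzero complex linear form and tau, the vertical
   distance from z to the boundary, tends to 0.  On the ball of radius
   rho = tau / eps around z one thus has Re l(w - z) < 2 tau, so that
   f = l(w - z) / (l(w - z) - 4 tau) maps D into the unit disc there.  Put
     v1 = rho^2 / (4 rad^2) |f|^2 + |w - z|^2 / (4 rad^2),
     v2 = (|w - z|^2 / rad^2)^(1 + sig),   (rho^2 / rad^2)^sig = 1/2,
   with rad larger than the diameter of D.  Then v1 <= v2 on the sphere of radius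
   rho, while v1 > v2 near z because of the exponent 1 + sig > 1; hence max(v1, v2),
   extended by v2 outside the ball, is an admissible competitor equal to v1 near z.
   Its Levi form at z is |l X|^2 / (64 eps^2 rad^2) + |X|^2 / (4 rad^2), so the indicatrix
   lies in a bounded slab of width O(eps), whose volume is O(eps^2).

   The gluing uses that subharmonicity is local.  The local condition used here
   compares u(x) with the mean of u over the four points x + s, x + is, x - s,
   x - is, up to o(|s|^2).  It passes to finite sums and rotations, so averaging u
   over the rotations of order m and applying the maximum principle gives
   u(0) <= a Riemann sum of u over the unit circle, up to an arbitrarily small
   error. *)
Require Import Defs.
From HB Require Import structures.
From mathcomp Require Import all_boot all_order all_algebra.
From mathcomp Require Import all_classical all_reals all_analysis.
From mathcomp Require Import measurable_realfun.
From mathcomp Require Import complex spectral ring lra.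
Set Implicit Arguments.
Unset Strict Implicit.
Unset Printing Implicit Defensive.
Import Order.TTheory GRing.Theory Num.Theory.
Import numFieldNormedType.Exports.
Local Open Scope classical_set_scope.
Local Open Scope ring_scope.
Local Notation Re := complex.Re.
Local Notation Im := complex.Im.
Local Open Scope complex_scope.

(** * Squared norms on C and C^n *)

Section SquaredNorm.
Context {R : realType}.
Implicit Types c d : R[i].

Definition sqnorm c : R := Re c ^+ 2 + Im c ^+ 2.

Lemma sqnorm_ge0 c : 0 <= sqnorm c.
Proof. by rewrite addr_ge0 ?sqr_ge0. Qed.

Lemma sqnorm0 : sqnorm 0 = 0.
Proof. by rewrite /sqnorm /= expr0n addr0. Qed.

Lemma sqnorm_eq0 c : (sqnorm c == 0) = (c == 0).
Proof.
by case: c => a b; rewrite /sqnorm paddr_eq0 ?sqr_ge0 //= !sqrf_eq0 eq_complex.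
Qed.

Lemma sqnormM c d : sqnorm (c * d) = sqnorm c * sqnorm d.
Proof. by case: c d => [a b] [a' b']; rewrite /sqnorm /=; ring. Qed.

Lemma sqnormN c : sqnorm (- c) = sqnorm c.
Proof. by case: c => a b; rewrite /sqnorm /= !sqrrN. Qed.

Lemma sqnormX c k : sqnorm (c ^+ k) = sqnorm c ^+ k.
Proof.
elim: k => [|k IH]; last by rewrite !exprS sqnormM IH.
by rewrite !expr0 /sqnorm /= expr1n expr0n addr0.
Qed.

Lemma sqnormV c : sqnorm c^-1 = (sqnorm c)^-1.
Proof.
have [->|c0] := eqVneq c 0; first by rewrite invr0 sqnorm0 invr0.
have sc0 : sqnorm c != 0 by rewrite sqnorm_eq0.
apply: (mulfI sc0); rewrite -sqnormM !mulfV // /sqnorm /=.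
by rewrite expr1n expr0n addr0.
Qed.

Lemma sqnormD_le c d : sqnorm (c + d) <= 2 * (sqnorm c + sqnorm d).
Proof.
case: c d => [a b] [a' b']; rewrite /sqnorm /=.
by have := sqr_ge0 (a - a'); have := sqr_ge0 (b - b'); nra.
Qed.

Lemma sqnorm_norm c : `|c| = (Num.sqrt (sqnorm c))%:C.
Proof. exact: normc_def. Qed.

Lemma sqnorm_real (x : R) : sqnorm x%:C = x ^+ 2.
Proof. by rewrite /sqnorm /= expr0n addr0. Qed.

Lemma Re_le_sqrt c : Re c <= Num.sqrt (sqnorm c).
Proof.
apply: le_trans (ler_norm _) _; rewrite -sqrtr_sqr ler_sqrt ?sqnorm_ge0 //.
by rewrite lerDl sqr_ge0.
Qed.

(** The norm of [R[i]] takes values in [R[i]], so radii of balls are complex numbers that happen to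
    be positive reals. Squared distances turn neighbourhoods into inequalities over [R]. *)
Lemma nbhs_sqnormP c (A : set R[i]) :
  nbhs c A <-> exists2 e : R, 0 < e & forall d, sqnorm (d - c) < e -> A d.
Proof.
split=> [/nbhs_ballP[e /= e0 eA]|[e e0 eA]].
  have re : e = (Re e)%:C by rewrite RRe_real ?gtr0_real.
  have Re0 : 0 < Re e by rewrite re ltcR in e0.
  exists (Re e ^+ 2); first by rewrite exprn_gt0.
  move=> d de; apply: eA; rewrite -ball_normE /= sqnorm_norm re ltcR.
  rewrite -(ger0_norm (ltW Re0)) -sqrtr_sqr ltr_sqrt ?exprn_gt0 //.
  by rewrite -sqnormN opprB.
apply/nbhs_ballP; exists (Num.sqrt e)%:C; first by rewrite /= ltcR sqrtr_gt0.
move=> d; rewrite -ball_normE /= sqnorm_norm ltcR ltr_sqrt // => de; apply: eA.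
by rewrite -sqnormN opprB.
Qed.

End SquaredNorm.

Section RowVectors.
Context {R : realType} {n : nat}.
Implicit Types X Y : 'rV[R[i]]_n.

Definition N2 X : R := \sum_j sqnorm (X 0 j).

Lemma N2_ge0 X : 0 <= N2 X.
Proof. by apply: sumr_ge0 => j _; exact: sqnorm_ge0. Qed.

Lemma le_N2 X j : sqnorm (X 0 j) <= N2 X.
Proof.
by rewrite /N2 (bigD1 j) //= lerDl sumr_ge0 // => k _; exact: sqnorm_ge0.
Qed.

Lemma N2_0 : N2 0 = 0.
Proof. by rewrite /N2 big1 // => j _; rewrite mxE sqnorm0. Qed.

Lemma N2Z a X : N2 (a *: X) = sqnorm a * N2 X.
Proof. by rewrite /N2 mulr_sumr; apply: eq_bigr => j _; rewrite mxE sqnormM. Qed.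

Lemma N2N X : N2 (- X) = N2 X.
Proof. by rewrite -scaleN1r N2Z /sqnorm /= sqrrN expr1n oppr0 expr0n addr0 mul1r. Qed.

Lemma N2D_le X Y : N2 (X + Y) <= 2 * (N2 X + N2 Y).
Proof.
rewrite /N2 -big_split mulr_sumr; apply: ler_sum => j _.
by rewrite mxE sqnormD_le.
Qed.

Lemma nbhs_N2P X (A : set 'rV[R[i]]_n) :
  nbhs X A <-> exists2 e : R, 0 < e & forall Y, N2 (Y - X) < e -> A Y.
Proof.
split=> [/nbhs_ballP[e /= e0 eA]|[e e0 eA]].
  have re : e = (Re e)%:C by rewrite RRe_real ?gtr0_real.
  have Re0 : 0 < Re e by rewrite re ltcR in e0.
  exists (Re e ^+ 2); first by rewrite exprn_gt0.
  move=> Y YX; apply: eA; split=> // i j; rewrite ord1 -ball_normE /= sqnorm_norm re ltcR.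
  rewrite -(ger0_norm (ltW Re0)) -sqrtr_sqr ltr_sqrt ?exprn_gt0 //.
  apply: le_lt_trans YX; rewrite -N2N opprB; apply: le_trans (le_N2 _ j).
  by rewrite !mxE.
(* Dividing by [n.+1] keeps the radius positive for n = 0 and makes the sum of the n coordinate
   bounds strictly less than [e]. *)
pose e' : R := Num.sqrt (e / n.+1%:R).
have e'0 : 0 < e' by rewrite sqrtr_gt0 divr_gt0.
apply/nbhs_ballP; exists e'%:C; first by rewrite /= ltcR.
move=> Y XY; apply: eA; rewrite -N2N opprB /N2.
apply: (@le_lt_trans _ _ (\sum_(j < n) (e / n.+1%:R))); last first.
  rewrite sumr_const card_ord -[ltLHS]mulr_natl mulrA ltr_pdivrMr // mulrC.
  by rewrite ltr_pM2l // ltr_nat.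
apply: ler_sum => j _; have := XY.2 0 j.
rewrite -ball_normE /= sqnorm_norm ltcR ltr_sqrt ?divr_gt0 // !mxE => /ltW;
  apply: le_trans; rewrite lexx //.
Qed.

End RowVectors.

(** * Subharmonic functions on the unit disc *)

Section Disc.
Context {R : realType}.
Implicit Types (u v : R[i] -> R) (x t s : R[i]).

Definition disc : set R[i] := [set x | sqnorm x <= 1].

Lemma Re_continuous : continuous (@complex.Re R).
Proof.
move=> x A /nbhs_ballP[e /= e0 eA]; apply/nbhs_sqnormP.
exists (e ^+ 2); first by rewrite exprn_gt0.
move=> y yx; apply: eA; rewrite -ball_normE /= -(ger0_norm (ltW e0)).
rewrite -(@ltr_pXn2r _ 2) ?nnegrE ?normr_ge0 // !real_normK ?num_real //.
apply: le_lt_trans yx; case: x y => [a b] [c d]; rewrite /sqnorm /=.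
by have := sqr_ge0 (d - b); nra.
Qed.

Lemma Im_continuous : continuous (@complex.Im R).
Proof.
move=> x A /nbhs_ballP[e /= e0 eA]; apply/nbhs_sqnormP.
exists (e ^+ 2); first by rewrite exprn_gt0.
move=> y yx; apply: eA; rewrite -ball_normE /= -(ger0_norm (ltW e0)).
rewrite -(@ltr_pXn2r _ 2) ?nnegrE ?normr_ge0 // !real_normK ?num_real //.
apply: le_lt_trans yx; case: x y => [a b] [c d]; rewrite /sqnorm /=.
by have := sqr_ge0 (c - a); nra.
Qed.

Lemma sqnorm_continuous : continuous (@sqnorm R).
Proof.
move=> x; have rx := @Re_continuous x; have ix := @Im_continuous x.
exact: (cvgD (cvgM rx rx) (cvgM ix ix)).
Qed.

Lemma Complex_cvg (T : Type) (F : set_system T) {FF : Filter F} (f g : T -> R)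
    (a b : R) :
  f z @[z --> F] --> a -> g z @[z --> F] --> b ->
  (f z +i* g z) @[z --> F] --> (a +i* b : R[i]).
Proof.
move=> fa gb A /nbhs_sqnormP[e e0 eA].
have : (f z - a) ^+ 2 + (g z - b) ^+ 2 @[z --> F] --> (a - a) ^+ 2 + (b - b) ^+ 2.
  by apply: cvgD; rewrite !expr2; apply: cvgM; apply: cvgB => //; exact: cvg_cst.
move=> /(cvgr_lt _) /(_ e); rewrite !subrr !expr0n /= addr0 => /(_ e0).
by apply: filterS => z; rewrite -/(sqnorm ((f z +i* g z) - (a +i* b))) => /eA.
Qed.

Lemma compact_disc : compact disc.
Proof.
pose F (w : R * R) : R[i] := w.1 +i* w.2.
have cF : continuous F.
  by move=> w; apply: Complex_cvg; by [exact: cvg_fst|exact: cvg_snd].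
pose K := [set w : R * R | w.1 ^+ 2 + w.2 ^+ 2 <= 1].
have -> : disc = F @` K.
  apply/seteqP; split=> [[a b] /= ab|_ [[a b] /= ab <-]]; last exact: ab.
  by exists (a, b).
apply: continuous_compact; first exact: continuous_subspaceT.
apply: (@subclosed_compact _ _ (`[(-1 : R), 1]%classic `*` `[(-1 : R), 1]%classic)).
- rewrite (_ : K = (fun w : R * R => w.1 ^+ 2 + w.2 ^+ 2) @^-1` [set x | x <= 1]) //.
  apply: closed_comp; last exact: closed_le.
  by move=> w _; rewrite /continuous_at; apply: cvgD; rewrite !expr2;
    apply: cvgM; by [exact: cvg_fst|exact: cvg_snd].
- by apply: compact_setX; exact: segment_compact.
- by move=> [a b]; rewrite /K /= !in_itv /= => ab; split; rewrite -ler_norml;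
    rewrite -(@ler_pXn2r _ 2) ?nnegrE // real_normK ?num_real // expr1n;
    apply: le_trans ab; rewrite ?lerDl ?lerDr sqr_ge0.
Qed.


(* Together with continuity, this four-point inequality characterizes
   subharmonic functions; unlike the integral mean value inequality it is
   visibly stable under finite sums and rotations. *)
Definition local_submean u x : Prop := forall eta : R, 0 < eta ->
  exists2 r : R, 0 < r & forall s, sqnorm s < r ->
    4 * u x <= u (x + s) + u (x + 'i * s) + u (x - s) + u (x - 'i * s)
               + eta * sqnorm s.

Lemma sqnorm_cross x s :
  sqnorm (x + s) + sqnorm (x + 'i * s) + sqnorm (x - s) + sqnorm (x - 'i * s)
  = 4 * (sqnorm x + sqnorm s).
Proof. by case: x s => [a b] [c d]; rewrite /sqnorm /=; ring. Qed.

Lemma sqnormi (x : R[i]) : sqnorm ('i * x) = sqnorm x.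
Proof. by case: x => a b; rewrite /sqnorm /=; ring. Qed.

(* At an interior maximum of [u + eps |x|^2] the four-point inequality would fail,
   since the four-point mean of [|x|^2] exceeds its value at x by [|s|^2]. *)
Lemma disc_max_principle u (eps : R) : 0 < eps ->
  {within disc, continuous u} ->
  (forall x, sqnorm x < 1 -> local_submean u x) ->
  exists2 t, sqnorm t = 1 & u 0 <= u t + eps.
Proof.
move=> eps0 cu lu.
have [||t /set_mem tD tmax] :=
  @compact_EVT_max _ R (fun x => u x + eps * sqnorm x) disc _ compact_disc.
- by exists 0; rewrite /disc /= sqnorm0.
- move=> x; apply: cvgD; first exact: cu.
  apply: cvgM; first exact: cvg_cst.
  exact: (continuous_subspaceT sqnorm_continuous).
have t0 := tmax 0 (mem_set _).
have := t0 _; rewrite sqnorm0 mulr0 addr0 /disc /= sqnorm0 => /(_ ler01) {}t0.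
have [t1|t1|t1] := ltgtP (sqnorm t) 1; last 2 first.
- by move: tD; rewrite /disc /= leNgt t1.
- by exists t => //; rewrite t1 mulr1 in t0.
have [r r0 ru] := lu _ t1 eps eps0.
pose d : R := (1 - sqnorm t) / 4.
have d0 : 0 < d by rewrite divr_gt0 // subr_gt0.
(* Young's inequality 2 Re(t conj(s)) <= k |t|^2 + |s|^2 / k with k = 2d, for which |t|^2 = 1 -
   2k. *)
have bd s : sqnorm s <= d ^+ 2 -> sqnorm (t + s) <= 1.
  pose k := 2 * d; have k0 : 0 < k by rewrite mulr_gt0.
  have -> : d ^+ 2 = k ^+ 2 / 4 by rewrite /k; field.
  have Tk : sqnorm t = 1 - 2 * k by rewrite /k /d; field.
  have T0 := sqnorm_ge0 t => sk.
  have : k * (sqnorm (t + s) - sqnorm t - sqnorm s) <= k ^+ 2 * sqnorm t + sqnorm s.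
    rewrite -subr_ge0; case: (t) (s) => [a b] [c e]; rewrite /sqnorm /=.
    have -> : k ^+ 2 * (a ^+ 2 + b ^+ 2) + (c ^+ 2 + e ^+ 2) - k * ((a + c) ^+ 2 + (b
      + e) ^+ 2 -
      (a ^+ 2 + b ^+ 2) - (c ^+ 2 + e ^+ 2)) = (k * a - c) ^+ 2 + (k * b - e) ^+ 2 by
        ring.
    by rewrite addr_ge0 ?sqr_ge0.
  rewrite Tk in T0 *; move: sk k0; set S := sqnorm s; set X := sqnorm (t + s).
  move=> sk k0 h; rewrite -(ler_pM2l k0); nra.
pose m := Num.min (r / 2) (d ^+ 2).
have m0 : 0 < m by rewrite lt_min exprn_gt0 // divr_gt0.
pose s := (Num.sqrt m)%:C : R[i].
have sm : sqnorm s = m by rewrite sqnorm_real sqr_sqrtr ?ltW.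
have mr : m < r by rewrite (@le_lt_trans _ _ (r / 2)) ?ge_min ?lexx // gtr_pMr //
  invf_lt1 ?ltr1n.
have md : m <= d ^+ 2 by rewrite ge_min lexx orbT.
have /= := ru s; rewrite sm => /(_ mr).
have := sqnorm_cross t s; rewrite sm.
have h y : sqnorm y = m -> u (t + y) + eps * sqnorm (t + y) <= u t + eps * sqnorm t.
  by move=> ym; apply: tmax; apply: mem_set; apply: bd; rewrite ym.
have h1 := h s sm; have h2 := h ('i * s) (etrans (sqnormi s) sm).
have h3 := h (- s) (etrans (sqnormN s) sm).
have h4 := h (- ('i * s)) (etrans (sqnormN _) (etrans (sqnormi s) sm)).
by move: h1 h2 h3 h4 m0 eps0; set A := sqnorm (t + s); set B := sqnorm _; set C :=
  sqnorm (t - s); set E := sqnorm (t - _); nra.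
Qed.

End Disc.

(** * Rotations, sums over equidistant points, and integrals on the circle *)

Section Circle.
Context {R : realType}.
Implicit Types (u v : R[i] -> R) (t s : R[i]).

Lemma expiD (a b : R) : expi (a + b) = expi a * expi b.
Proof. by rewrite /expi cosD sinD; apply/eqP; rewrite eq_complex /=; apply/andP;
  split; apply/eqP => //; ring. Qed.

Lemma expi2pi : expi (2 * pi) = 1 :> R[i].
Proof. by rewrite /expi mulr_natl cos2pi sin2pi. Qed.

Lemma sqnorm_expi (a : R) : sqnorm (expi a) = 1.
Proof. exact: cos2Dsin2. Qed.

Lemma expi_continuous : continuous (@expi R).
Proof. by move=> a; apply: Complex_cvg;
  [exact: continuous_cos|exact: continuous_sin]. Qed.

(** The angle is taken nonnegative so that [circle_mean] can count with [Num.truncn] the grid steps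
    below it. *)
Lemma expi_surj t : sqnorm t = 1 -> exists2 a : R, 0 <= a & t = expi a.
Proof.
case: t => a b; rewrite /sqnorm /= => ab.
have a1 : -1 <= a <= 1.
  by rewrite -ler_norml -(@ler_pXn2r _ 2) ?nnegrE // real_normK ?num_real // expr1n
    -ab lerDl sqr_ge0.
have bE : Num.sqrt (1 - a ^+ 2) = `|b| by rewrite -ab addrC addKr sqrtr_sqr.
have [b0|b0] := leP 0 b.
  exists (acos a); first exact: acos_ge0.
  by rewrite /expi acosK ?in_itv // sin_acos // bE ger0_norm.
exists (2 * pi - acos a).
  by rewrite subr_ge0 (le_trans (acos_lepi a1)) // ler_peMl ?pi_ge0 ?ler1n.
rewrite expiD expi2pi mul1r /expi cosN sinN acosK ?in_itv // sin_acos // bE.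
by rewrite ltr0_norm // opprK.
Qed.

Lemma mulr_within_disc (c x : R[i]) : sqnorm c = 1 -> disc x ->
  c * y @[y --> within disc (nbhs x)] --> within disc (nbhs (c * x)).
Proof.
move=> c1 dx A /= /nbhs_sqnormP[e e0 eA].
apply/nbhs_sqnormP; exists e => // y yx dy; apply: eA.
  by rewrite -mulrBr sqnormM c1 mul1r.
by rewrite /disc /= sqnormM c1 mul1r.
Qed.

Lemma disc_continuousP u : {within disc, continuous u} <->
  forall x, disc x -> u y @[y --> within disc (nbhs x)] --> u x.
Proof. exact: subspace_continuousP. Qed.

Lemma local_submean_rot u (c x : R[i]) : sqnorm c = 1 ->
  local_submean u (c * x) -> local_submean (fun t => u (c * t)) x.
Proof.
move=> c1 lu eta eta0; have [r r0 ru] := lu eta eta0.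
exists r => // s sr; have := ru (c * s); rewrite sqnormM c1 mul1r => /(_ sr).
by rewrite ['i * (c * s)]mulrCA !mulrDr !mulrN.
Qed.

Lemma local_submeanD u v (x : R[i]) :
  local_submean u x -> local_submean v x -> local_submean (u \+ v) x.
Proof.
move=> lu lv eta eta0.
have e2 : 0 < eta / 2 by rewrite divr_gt0.
have [r r0 ru] := lu _ e2; have [q q0 qv] := lv _ e2.
exists (Num.min r q); first by rewrite lt_min r0.
by move=> s; rewrite lt_min => /andP[/ru + /qv] /=; lra.
Qed.

Lemma local_submean0 (x : R[i]) : local_submean (fun=> 0) x.
Proof.
move=> eta eta0; exists 1 => // s _.
by rewrite mulr0 !addr0 add0r mulr_ge0 ?sqnorm_ge0 // ltW.
Qed.

Definition rot_sum u (m : nat) (h : R) t := \sum_(k < m) u (expi (k%:R * h) * t).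

(** A sum of rotated copies of u inherits continuity and the four-point inequality, so the maximum
    principle applies to it. At 0 all m copies agree; at a boundary point they list the values of u
    on a shifted grid. *)
Lemma rot_sum_max u m h (eps : R) : 0 < eps ->
  {within disc, continuous u} ->
  (forall x, sqnorm x < 1 -> local_submean u x) ->
  exists2 a : R, 0 <= a & m%:R * u 0 <= \sum_(k < m) u (expi (k%:R * h + a)) + eps.
Proof.
move=> eps0 cu lu.
have [||t t1 ut] := @disc_max_principle R (rot_sum u m h) eps eps0.
- apply/disc_continuousP => x dx.
  rewrite /rot_sum; elim: m => [|m IH].
    by under eq_fun do rewrite big_ord0; rewrite big_ord0; exact: cvg_cst.
  under eq_fun do rewrite big_ord_recr; rewrite big_ord_recr.
  apply: (cvgD IH).
  have := mulr_within_disc (sqnorm_expi (m%:R * h)) dx.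
  move/cvg_comp; apply; move/disc_continuousP : cu; apply.
  by rewrite /disc /= sqnormM sqnorm_expi mul1r.
- move=> x x1; rewrite /rot_sum; elim: m => [|m IH].
    by under eq_fun do rewrite big_ord0; exact: local_submean0.
  under eq_fun do rewrite big_ord_recr.
  have L : local_submean (fun t => u (expi (m%:R * h) * t)) x.
    apply: (@local_submean_rot u); first exact: sqnorm_expi.
    by apply: lu; rewrite sqnormM sqnorm_expi mul1r.
  exact: (local_submeanD IH L).
have [a a0 ta] := expi_surj t1; exists a => //.
move: ut; rewrite /rot_sum ta.
under eq_bigr do rewrite mulr0.
rewrite sumr_const card_ord mulr_natl => /le_trans; apply.
by rewrite lerD2r; under eq_bigr do rewrite -expiD.
Qed.

(** A shift by one step sends each term to its successor and, by periodicity, the last one to the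
    first. *)
Lemma periodic_sum_shift (G : R -> R) (m : nat) (h a : R) (j : nat) :
  (forall b, G (b + m%:R * h) = G b) ->
  \sum_(k < m) G (k%:R * h + (a + j%:R * h)) = \sum_(k < m) G (k%:R * h + a).
Proof.
move=> Gm; elim: j => [|j IH]; first by rewrite mul0r addr0.
rewrite -IH -natr1 mulrDl mul1r addrA; move: (a + j%:R * h) => b.
case: m Gm {IH} => [|m] Gm; first by rewrite !big_ord0.
rewrite big_ord_recr big_ord_recl /= addrC; congr (_ + _).
  rewrite mul0r add0r -[RHS]Gm; congr G.
  by rewrite -natr1; ring.
by apply: eq_bigr => k _; congr G; rewrite /bump /= add1n -natr1; ring.
Qed.

Lemma uniform_continuous_segment (G : R -> R) (a b : R) : continuous G ->
  forall e : R, 0 < e -> exists2 d : R, 0 < d &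
    forall x y : R, a <= x <= b -> `|y - x| < d -> `|G y - G x| < e.
Proof.
move=> cG e e0.
have := @segment_compact R a b; rewrite compact_near_coveringP.
move=> /(_ R 0^'+ (fun d x => forall y, `|y - x| < d -> `|G y - G x| < e) _) [].
  move=> x _.
  have e2 : 0 < e / 2 by rewrite divr_gt0.
  have /cvgr_dist_lt /(_ _ e2) := cG x => /nbhs_ballP[d /= d0 dG].
  have d2 : 0 < d / 2 by rewrite divr_gt0.
  exists (ball x (d / 2), [set z | 0 < z < d / 2]).
    split; first exact: nbhsx_ballx.
    near=> z; apply/andP; split; near: z; first exact: nbhs_right_gt.
    exact: nbhs_right_lt.
  move=> [x' z] /= [+ /andP[z0 zd]] y yx'.
  rewrite -ball_normE /= => xx'.
  have h1 : `|G x - G x'| < e / 2.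
    by apply: dG; rewrite -ball_normE /= (lt_trans xx') // gtr_pMr // invf_lt1 ?ltr1n.
  have h2 : `|G x - G y| < e / 2.
    apply: dG; rewrite -ball_normE /= (le_lt_trans (ler_distD x' _ _)) //.
    by rewrite [ltRHS]splitr ltrD // distrC (lt_trans yx').
  rewrite (le_lt_trans (ler_distD (G x) _ _)) // [ltRHS]splitr ltrD // distrC //.
move=> d /= d0 dG; exists (d / 2); first by rewrite divr_gt0.
move=> x y xab; apply: (dG (d / 2)) => /=.
- by rewrite sub0r normrN gtr0_norm ?divr_gt0 // gtr_pMr // invf_lt1 ?ltr1n.
- by rewrite divr_gt0.
- by rewrite in_itv.
Unshelve. all: by end_near.
Qed.

(** Trades the Lebesgue integral for a primitive, which the mean value theorem can compare with
    Riemann sums. *)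
Lemma antiderivative (G : R -> R) (b : R) : continuous G -> 0 < b ->
  exists F : R -> R, [/\ (forall x : R, 0 <= x <= b -> is_derive x (1:R) F (G x)) &
    (\int[lebesgue_measure]_(x in `[0%R, b]%classic) (G x)%:E = (F b - F 0)%:E)%E].
Proof.
move=> cG b0.
(* Integrating from -1 makes 0 an interior point, so that [F] has a two-sided derivative there. *)
pose F (x : R) := (\int[lebesgue_measure]_(t in [set` Interval (BLeft (-1)) (BRight
  x)]) (G t))%R : R.
have dF x : 0 <= x <= b -> derivable F x 1 /\ derive1 F x = G x.
  move=> /andP[x0 xb]; apply: (@continuous_FTC1 R G (BLeft (-1)) x (b + 1)) => //.
  - by rewrite (le_lt_trans xb) // ltrDl.
  - apply: continuous_compact_integrable; first exact: segment_compact.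
    exact: continuous_subspaceT.
  - by rewrite /= lte_fin; lra.
  - exact: cG.
clearbody F; exists F; split.
  move=> x xb; have [dx <-] := dF x xb.
  by apply: DeriveDef => //; rewrite derive1E.
rewrite (@continuous_FTC2 R G F 0 b) //.
- exact: continuous_subspaceT.
- split.
  + by move=> x; rewrite in_itv /= => /andP[x0 xb]; apply: (dF x _).1; rewrite !ltW.
  + apply: cvg_at_right_filter; apply: differentiable_continuous.
    by apply/derivable1_diffP; apply: (dF 0 _).1; rewrite lexx ltW.
  + apply: cvg_at_left_filter; apply: differentiable_continuous.
    by apply/derivable1_diffP; apply: (dF b _).1; rewrite lexx ltW.
- by move=> x; rewrite in_itv /= => /andP[x0 xb]; apply: (dF x _).2; rewrite !ltW.
Qed.

End Circle.

(** * The sub-mean value inequality on the unit circle *)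

Section Mean.
Context {R : realType}.
Implicit Types (u : R[i] -> R).

(** On each cell the increment of F is h G(c) for some c in the cell, and G(c) differs from the
    value at the left end by less than eps. *)
Lemma left_riemann_sum (F G : R -> R) (h eps d : R) (m : nat) : 0 < h < d ->
  (forall x, 0 <= x <= m%:R * h -> is_derive x (1:R) F (G x)) ->
  (forall x y, 0 <= x <= m%:R * h -> `|y - x| < d -> `|G y - G x| < eps) ->
  \sum_(k < m) G (k%:R * h) * h <= F (m%:R * h) - F 0 + m%:R * h * eps.
Proof.
move=> /andP[h0 hd] dF uG.
suff S j : (j <= m)%N ->
    \sum_(k < j) G (k%:R * h) * h <= F (j%:R * h) - F 0 + j%:R * h * eps by exact: S.
elim: j => [_|j IH jm]; first by rewrite big_ord0 !mul0r subrr addr0.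
rewrite big_ord_recr /= (le_trans (lerD (IH (ltnW jm)) (lexx _))) //.
have jh : j%:R * h < j.+1%:R * h by rewrite ltr_pM2r // ltr_nat.
have j0 : 0 <= j%:R * h by rewrite mulr_ge0 // ltW.
have jm' : j.+1%:R * h <= m%:R * h by rewrite ler_pM2r // ler_nat.
have dFj x : x \in `]j%:R * h, j.+1%:R * h[ -> is_derive x (1:R) F (G x).
  rewrite in_itv /= => /andP[jx xj]; apply: dF.
  by rewrite (le_trans j0 (ltW jx)) (le_trans (ltW xj) jm').
have [|c cj E] := MVT jh dFj.
  apply: derivable_within_continuous => x; rewrite in_itv /= => /andP[jx xj].
  suff [] : is_derive x (1:R) F (G x) by [].
  by apply: dF; rewrite (le_trans j0 jx) (le_trans xj jm').
have jE : j.+1%:R * h - j%:R * h = h by rewrite -natr1; ring.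
have : `|G c - G (j%:R * h)| < eps.
  move: cj; rewrite in_itv /= => /andP[jc cj].
  apply: uG; first by rewrite j0 /= (le_trans (ltW jh)).
  by rewrite gtr0_norm ?subr_gt0 // (lt_trans _ hd) // -[ltRHS]jE ltrD2r.
rewrite jE in E; rewrite ltr_norml => /andP[+ _].
rewrite -(ltr_pM2r h0); move: E; set X := F (j.+1%:R * h); rewrite -natr1.
by lra.
Qed.

Lemma circle_continuous u : {within disc, continuous u} ->
  continuous (u \o expi).
Proof.
move=> cu a; have dx (b : R) : disc (expi b) by rewrite /disc /= sqnorm_expi.
have /(_ _ (dx a)) := (disc_continuousP u).1 cu.
apply: cvg_comp => A /=; rewrite /within /= => wA.
have : nbhs a (@expi R @^-1` [set z | disc z -> A z]) by exact: expi_continuous wA.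
by apply: filterS => b /=; apply; exact: dx.
Qed.

(** The maximum principle bounds u(0) by the mean over a grid with unknown offset a. Removing whole
    steps brings the offset into [0, h), where uniform continuity replaces the shifted grid by the
    standard one; its Riemann sum is close to the integral. *)
Lemma circle_mean u :
  {within disc, continuous u} ->
  (forall x : R[i], sqnorm x < 1 -> local_submean u x) ->
  ((2 * pi * u 0)%:E <=
   \int[lebesgue_measure]_(t in `[0%R, (2 * pi)%R]%classic) (u (expi t))%:E)%E.
Proof.
move=> cu lu; pose G (t : R) := u (expi t).
have pi2 : 0 < 2 * pi :> R by rewrite mulr_gt0 // pi_gt0.
have cG : continuous G by exact: circle_continuous.
have [F [dF ->]] := antiderivative cG pi2.
rewrite lee_fin; apply/ler_addgt0Pr => e e0.
(* Three errors of 2 pi eps each: maximum principle, offset of the grid, Riemann sum. *)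
pose eps := e / (6 * pi).
have eps0 : 0 < eps by rewrite divr_gt0 // mulr_gt0 // pi_gt0.
have [d d0 dG] := @uniform_continuous_segment _ G 0 (2 * pi) cG eps eps0.
pose m := (Num.truncn (2 * pi / d)).+1.
have m0 : 0 < m%:R :> R by rewrite ltr0n.
pose h : R := 2 * pi / m%:R.
have h0 : 0 < h by rewrite divr_gt0.
have hd : h < d.
  rewrite ltr_pdivrMr // -ltr_pdivrMl // mulrC.
  by rewrite truncnS_gt.
have mh : m%:R * h = 2 * pi by rewrite mulrC divfK ?gt_eqF.
have [a a0 ua] := @rot_sum_max R u m h (eps * m%:R) (mulr_gt0 eps0 m0) cu lu.
have Gper b : G (b + m%:R * h) = G b by rewrite mh /G expiD expi2pi mulr1.
pose j := Num.truncn (a / h).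
have jle : j%:R * h <= a.
  by rewrite -ler_pdivlMr // truncn_le // divr_ge0 // ltW.
have jlt : a - j%:R * h < h.
  have : a / h < j.+1%:R by rewrite truncnS_gt.
  by rewrite ltr_pdivrMr // -natr1 mulrDl mul1r; lra.
have ub : \sum_(k < m) u (expi (k%:R * h + a)) <= \sum_(k < m) (G (k%:R * h) + eps).
  rewrite (_ : a = (a - j%:R * h) + j%:R * h); last by rewrite subrK.
  rewrite (@periodic_sum_shift _ G) //; apply: ler_sum => k _.
  have kh : 0 <= k%:R * h <= 2 * pi.
    rewrite mulr_ge0 ?(ltW h0) //= -mh ler_pM2r // ler_nat.
    exact: ltnW (ltn_ord k).
  have := dG (k%:R * h) (k%:R * h + (a - j%:R * h)) kh.
  rewrite addrAC subrr add0r ger0_norm ?subr_ge0 // => /(_ (lt_trans jlt hd)).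
  by rewrite ltr_norml => /andP[_]; lra.
rewrite big_split /= sumr_const card_ord -mulr_natr in ub.
have := @left_riemann_sum F G h eps d m.
rewrite h0 hd mh -mulr_suml => /(_ isT dF dG).
have -> : 2 * pi * u 0 = h * (m%:R * u 0) by rewrite -mh; ring.
have : h * (m%:R * u 0) <= h * (\sum_(k < m) G (k%:R * h) + eps * m%:R + eps * m%:R).
  by rewrite ler_pM2l // (le_trans ua) // lerD2r.
have -> : h * (\sum_(k < m) G (k%:R * h) + eps * m%:R + eps * m%:R) =
   (\sum_(k < m) G (k%:R * h)) * h + 2 * (2 * pi) * eps by rewrite -mh; ring.
have : 3 * (2 * pi) * eps = e.
  have pi0 : (pi : R) != 0 by rewrite gt_eqF // pi_gt0.
  by rewrite /eps; move: (pi : R) pi0 => q q0; field.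
by lra.
Qed.

End Mean.

(** * Logarithmically subharmonic functions *)

Section LogSubmean.
Context {R : realType}.
Implicit Types (g : R[i] -> R).

(** The four-point inequality for log g in exponentiated form: products of values are meaningful at
    zeros of g as well. *)
Definition local_log_submean g (x : R[i]) : Prop := forall eta : R, 0 < eta ->
  exists2 r : R, 0 < r & forall s, sqnorm s < r ->
    g x ^+ 4 * (1 - eta * sqnorm s) <=
    g (x + s) * g (x + 'i * s) * g (x - s) * g (x - 'i * s).

Lemma ln1B_ge (y : R) : 0 <= y <= 2^-1 -> - (2 * y) <= ln (1 - y).
Proof.
move=> /andP[y0 y2].
have y1 : 0 < 1 - y by rewrite subr_gt0 (le_lt_trans y2) // invf_lt1 ?ltr1n.
rewrite -[ln _]opprK -lnV ?posrE // lerN2.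
have -> : (1 - y)^-1 = 1 + y / (1 - y) by field; rewrite gt_eqF.
apply: le_trans (le_ln1Dx _) _.
  by rewrite (@lt_le_trans _ _ 0) ?ltrN10 // divr_ge0 // ltW.
by rewrite ler_pdivrMr //; nra.
Qed.

(** Truncation at c keeps the logarithm finite. Where g x <= c, the value ln c is a global minimum
    and the inequality is clear; elsewhere one takes logarithms, the truncation only increasing the
    right-hand side. *)
Lemma local_submean_ln g (c : R) (x : R[i]) : 0 < c -> (forall y, 0 <= g y) ->
  (0 < g x -> local_log_submean g x) ->
  local_submean (fun y => ln (Num.max (g y) c)) x.
Proof.
move=> c0 g0 lg eta eta0.
have m0 y : 0 < Num.max (g y) c by rewrite lt_max c0 orbT.
have [gc|gc] := leP (g x) c.
  exists 1 => // s _; have h y : ln c <= ln (Num.max (g y) c).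
    by rewrite ler_ln ?posrE // le_max lexx orbT.
  have := h (x + s); have := h (x + 'i * s); have := h (x - s).
  have := h (x - 'i * s).
  have : 0 <= eta * sqnorm s by rewrite mulr_ge0 ?sqnorm_ge0 // ltW.
  by lra.
have gx0 := lt_trans c0 gc.
have e2 : 0 < eta / 2 by rewrite divr_gt0.
have [r r0 rg] := lg gx0 _ e2.
(* The bound |s|^2 < 1 / eta puts eta |s|^2 / 2 in the range of [ln1B_ge]. *)
exists (Num.min r eta^-1); first by rewrite lt_min r0 invr_gt0.
move=> s; rewrite lt_min => /andP[sr se].
have s0 := sqnorm_ge0 s.
have y2 : 0 <= eta / 2 * sqnorm s <= 2^-1.
  rewrite mulr_ge0 ?(ltW e2) //=.
  move: se; rewrite -[eta^-1]mul1r ltr_pdivlMr // => se.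
  by lra.
have := ln1B_ge y2.
have y1 : 0 < 1 - eta / 2 * sqnorm s.
  by rewrite subr_gt0 (le_lt_trans (proj2 (andP y2))) // invf_lt1 ?ltr1n.
have : ln (g x ^+ 4 * (1 - eta / 2 * sqnorm s)) <=
    ln (Num.max (g (x + s)) c * Num.max (g (x + 'i * s)) c
      * Num.max (g (x - s)) c * Num.max (g (x - 'i * s)) c).
  rewrite ler_ln ?posrE ?mulr_gt0 ?exprn_gt0 //.
  apply: le_trans (rg _ sr) _.
  by do !apply: ler_pM => //; rewrite ?mulr_ge0 // le_max lexx.
have -> : ln (g x ^+ 4 * (1 - eta / 2 * sqnorm s)) =
    4 * ln (g x) + ln (1 - eta / 2 * sqnorm s).
  by rewrite lnM ?posrE ?exprn_gt0 // lnXn // mulr_natl.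
by rewrite !lnM ?posrE ?mulr_gt0 //; lra.
Qed.

End LogSubmean.

(** * From the four-point inequality to plurisubharmonicity *)

Section Psh.
Context {R : realType} {n : nat}.
Implicit Types (v : 'rV[R[i]]_n -> R) (D : set 'rV[R[i]]_n).

Lemma cvg_maxr (T : Type) (F : set_system T) {FF : Filter F} (f g : T -> R)
    (a b : R) : f x @[x --> F] --> a -> g x @[x --> F] --> b ->
  Num.max (f x) (g x) @[x --> F] --> Num.max a b.
Proof.
move=> fa gb; rewrite maxr_absE; under eq_fun do rewrite maxr_absE.
apply: cvgM; last exact: cvg_cst.
by apply: cvgD; [exact: cvgD|apply: cvg_norm; exact: cvgB].
Qed.

Lemma lne_lt_EFin (x r : R) : (lne x%:E < r%:E)%E = (x < expR r).
Proof.
rewrite /=; case: ifPn => [x0|]; first by rewrite ltNyr (le_lt_trans x0) ?expR_gt0.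
by rewrite -ltNge => x0; rewrite lte_fin -[in RHS](lnK x0) ltr_expR.
Qed.

Lemma affine_disc_continuous (a b : 'rV[R[i]]_n) :
  continuous (fun x : R[i] => a + x *: b).
Proof.
move=> x A /nbhs_N2P[e e0 eA]; apply/nbhs_sqnormP.
have k0 : 0 < N2 b + 1 by rewrite ltr_wpDl ?N2_ge0.
exists (e / (N2 b + 1)); first by rewrite divr_gt0.
move=> y yx; apply: eA.
rewrite opprD addrACA subrr add0r -scalerBl N2Z.
rewrite ltr_pdivlMr // in yx; apply: le_lt_trans yx.
by rewrite ler_wpM2l ?sqnorm_ge0 // lerDl.
Qed.

(** The logarithms truncated at exp(-K) are continuous, so [circle_mean] applies to each. They
    decrease to log v and are nonpositive since v < 1, so monotone convergence of their negatives
    carries the inequality to the limit, the value -oo included. *)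
Lemma log_psh D v : (forall w, 0 <= v w) -> (forall w, D w -> v w < 1) ->
  (forall w, D w -> {for w, continuous v}) ->
  (forall a b, D a -> 0 < v a -> local_log_submean (fun x => v (a + x *: b)) 0) ->
  psh_on D (fun w => lne (v w)%:E).
Proof.
move=> v0 v1 cv lv; split.
- move=> a Da; rewrite /=; case: ifP => // _; exact: ltry.
- move=> a r Da ar.
  move: ar; rewrite lne_lt_EFin => /(cvgr_lt _ (cv a Da)) va.
  by apply: filterS va => w vw _; rewrite lne_lt_EFin.
move=> a b Dab.
have Da : D a by have := Dab 0; rewrite normr0 ler01 scale0r addr0; apply.
have Db x : disc x -> D (a + x *: b).
  rewrite /disc /= => x1; apply: Dab; rewrite sqnorm_norm lecR.
  by rewrite -(sqrtr1 R) ler_sqrt.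
have [va0|va0] := leP (v a) 0; first by rewrite le0_lneNy ?leNye // lee_fin.
pose c (K : nat) : R := expR (- K%:R).
have c0 K : 0 < c K by exact: expR_gt0.
pose u K (x : R[i]) := ln (Num.max (v (a + x *: b)) (c K)).
have m0 K y : 0 < Num.max (v y) (c K) by rewrite lt_max c0 orbT.
have cu K : {within disc, continuous (u K)}.
  apply/disc_continuousP => x dx; apply: cvg_within_filter.
  have cva : v (a + y *: b) @[y --> x] --> v (a + x *: b).
    by apply: cvg_comp (@affine_disc_continuous a b x) (cv _ (Db x dx)).
  have cm : Num.max (v (a + y *: b)) (c K) @[y --> x] --> Num.max (v (a + x *: b)) (c K).
    exact: (cvg_maxr cva (cvg_cst _)).
  exact: (cvg_comp _ _ cm (continuous_ln (m0 K _))).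
have lu K x : sqnorm x < 1 -> local_submean (u K) x.
  move=> x1; apply: (@local_submean_ln _ (fun y => v (a + y *: b))) => // vx.
  move=> eta eta0; have [r r0 rv] := lv _ b (Db x (ltW x1)) vx eta eta0.
  exists r => // s /rv; rewrite scale0r addr0 !add0r.
  by rewrite !scalerDl !addrA !scaleNr.
have main K : ((2 * pi * u K 0%R)%:E <=
  \int[lebesgue_measure]_(t in `[0%R, (2 * pi)%R]%classic) (u K (expi t))%:E)%E.
  exact: (@circle_mean R (u K) (cu K) (lu K)).
have Dt t : D (a + expi t *: b) by apply: Db; rewrite /disc /= sqnorm_expi.
pose g K (t : R) : \bar R := (- (u K (expi t)))%:E.
have c1 K : c K <= 1 by rewrite /c -expR0 ler_expR oppr_le0.
have g0 K t : `[0%R, (2 * pi)%R]%classic t -> (0 <= g K t)%E.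
  move=> _; rewrite lee_fin oppr_ge0 ln_le0 // ge_max c1 andbT.
  exact: ltW (v1 _ (Dt t)).
have gnd t : `[0%R, (2 * pi)%R]%classic t -> nondecreasing_seq (g ^~ t).
  move=> _ K L KL; rewrite lee_fin lerN2 ler_ln ?posrE //.
  by rewrite ge_max le_max lexx /= le_max ler_expR lerN2 ler_nat KL orbT.
have mg K : measurable_fun (`[0%R, (2 * pi)%R]%classic : set R) (g K).
  apply/measurable_EFinP; apply: measurable_funTS; apply: continuous_measurable_fun.
  by move=> t; apply: cvgN; exact: (circle_continuous (cu K)).
(* At a zero of v the negated truncated logarithm is K, which tends to +oo; elsewhere the truncation
   is eventually inactive. *)
have gl t : g K t @[K --> \oo] --> (- lne (v (a + expi t *: b)%R)%:E)%E.
  rewrite /g /u; move: (v0 (a + expi t *: b)); move: (v _) => y.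
  rewrite le_eqVlt => /predU1P[<-|y0].
    rewrite le0_lneNy //=; apply/cvgeryP.
    under eq_fun do rewrite max_r ?(ltW (c0 _)) // expRK opprK.
    exact: cvgr_idn.
  rewrite lne_EFin //; apply: cvg_near_cst.
  near=> K; rewrite max_l // -(lnK y0) ler_expR lerNl.
  near: K; exact: nbhs_infty_ger.
have mD : measurable (`[0%R, (2 * pi)%R]%classic : set R) by exact: measurable_itv.
have cvi := @cvg_monotone_convergence _ _ _ lebesgue_measure _ mD g mg g0 gnd.
have le_lim : (\int[lebesgue_measure]_(t in `[0%R, (2 * pi)%R]%classic)
      (- lne (v (a + expi t *: b)%R)%:E) <= (- (2 * pi * ln (v a)))%:E)%E.
  under eq_integral do rewrite -(cvg_lim _ (gl _)) //.
  rewrite -(cvg_lim _ cvi) //; apply: lime_le; first by apply/cvg_ex; eexists; exact: cvi.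
  apply: nearW => K; rewrite /g.
  have /(le_trans _) := main K; move=> /(_ (2 * pi * ln (v a))%:E).
  rewrite lee_fin ler_pM2l ?mulr_gt0 ?pi_gt0 // /u scale0r addr0 ler_ln ?posrE //.
  rewrite le_max lexx => /(_ isT) h.
  rewrite EFinN leeNr; apply: le_trans h _.
  rewrite -integral_ge0N; last by move=> t tD; exact: g0.
  by under [leRHS]eq_integral do rewrite -EFinN opprK.
have pi2 : 0 < (2 * pi)^-1 :> R by rewrite invr_gt0 mulr_gt0 ?pi_gt0.
have -> : lne (v a)%:E = (((2 * pi)^-1)%:E * (2 * pi * ln (v a))%:E)%E.
  by rewrite lne_EFin // -EFinM mulKf // -invr_eq0 gt_eqF.
apply: lee_wpmul2l; first by rewrite lee_fin ltW.
rewrite EFinN leeNr in le_lim; apply: le_trans le_lim _.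
rewrite -integral_ge0N; last first.
  by move=> t _; rewrite oppe_ge0 lne_le0 lee_fin; exact: ltW (v1 _ (Dt t)).
by under eq_integral do rewrite oppeK.
Unshelve. all: by end_near.
Qed.

End Psh.

(** * Functions touched from below by squared moduli of rational functions *)

Section Touching.
Context {R : realType}.
Implicit Types (g : R[i] -> R).

(** Young's inequality |2 Re x| <= k + |x|^2 / k. It is applied with k = |s|^4 to x = s^4 times a
    bounded factor. *)
Lemma sqnorm_1D_ge (x : R[i]) (k e : R) : 0 < k -> sqnorm x <= k ^+ 2 * e ->
  1 - k * (1 + e) <= sqnorm (1 + x).
Proof.
case: x => a b; rewrite /sqnorm /= => k0 xe.
have h : - (2 * k * a) <= k ^+ 2 + a ^+ 2.
  by rewrite -subr_ge0; have := sqr_ge0 (k + a); lra.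
rewrite -(ler_pM2l k0); have := sqr_ge0 a; have := sqr_ge0 b; nra.
Qed.

Lemma sqnorm_1D_le (x : R[i]) (k e : R) : 0 < k -> sqnorm x <= k ^+ 2 * e ->
  sqnorm (1 + x) <= 1 + k * (1 + e) + k ^+ 2 * e.
Proof.
case: x => a b; rewrite /sqnorm /= => k0 xe.
have h : 2 * k * a <= k ^+ 2 + a ^+ 2.
  by rewrite -subr_ge0; have := sqr_ge0 (k - a); lra.
rewrite -(ler_pM2l k0); have := sqr_ge0 a; have := sqr_ge0 b; nra.
Qed.

(* The rational function h = (1 + al s + be s^2) / (1 + mu s) gives a lower bound
   [g 0 * |h|^2] of g that is sharp at 0, and the product of h over the four points
   s, is, -s, -is is 1 + O(s^4). *)
Lemma log_submean_touching g (al be mu : R[i]) (r0 : R) :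
  0 < g 0 -> 0 < r0 -> (forall s, 0 <= g s) ->
  (forall s, sqnorm s < r0 ->
    g 0 * sqnorm (1 + al * s + be * s ^+ 2) <= g s * sqnorm (1 + mu * s)) ->
  local_log_submean g 0.
Proof.
move=> g00 r00 g0 gh eta eta0.
(* The product of 1 + al y + be y^2 over y = s, is, -s, -is is 1 + s^4 [E s]; likewise the factors 1
   + mu y multiply to 1 - mu^4 s^4. *)
pose E (s : R[i]) := - 2%:R * be ^+ 2 + 4%:R * al ^+ 2 * be - al ^+ 4 + be ^+ 4 * s ^+ 4.
pose e := 2 * (sqnorm (- 2%:R * be ^+ 2 + 4%:R * al ^+ 2 * be - al ^+ 4) + sqnorm (be
  ^+ 4)).
pose m := sqnorm (- mu ^+ 4).
have m0 : 0 <= m by exact: sqnorm_ge0.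
have e0 : 0 <= e by rewrite mulr_ge0 // addr_ge0 ?sqnorm_ge0.
(* [C] dominates the constants of all errors of order |s|^4; once |s|^2 C < eta, the allowance eta
   |s|^2 absorbs them. *)
pose C := 4 + e + 2 * m.
have C0 : 0 < C by rewrite /C; lra.
exists (Num.min (Num.min r0 C^-1) (Num.min eta^-1 (eta / C))).
  by rewrite !lt_min r00 !invr_gt0 divr_gt0 ?eta0 ?C0.
move=> s; rewrite !lt_min => /andP[/andP[sr sC] /andP[seta setaC]].
rewrite !add0r.
have [->|sn0] := eqVneq s 0.
  by rewrite sqnorm0 mulr0 subr0 mulr1 oppr0 mulr0 oppr0 -!expr2 -exprSr -exprSr.
set S := sqnorm s in sr sC seta setaC *.
have S0 : 0 < S by rewrite lt_neqAle eq_sym sqnorm_eq0 sn0 sqnorm_ge0.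
have SC : S * C < 1 by rewrite -ltr_pdivlMr // mul1r.
have S1 : S < 1 by apply: le_lt_trans SC; rewrite ler_peMr ?ltW // /C; lra.
have Se : S * eta < 1 by rewrite -ltr_pdivlMr // mul1r.
have SCe : S * C < eta by rewrite -ltr_pdivlMr.
have k0 : 0 < S ^+ 2 by rewrite exprn_gt0.
have sE : sqnorm (s ^+ 4 * E s) <= (S ^+ 2) ^+ 2 * e.
  rewrite sqnormM sqnormX -/S -exprM ler_pM2l ?exprn_gt0 //.
  rewrite /E (le_trans (sqnormD_le _ _)) // ler_pM2l // lerD2l sqnormM [sqnorm (s ^+
    4)]sqnormX -/S.
  by rewrite ler_piMr ?sqnorm_ge0 // exprn_ile1 // ltW.
have sm : sqnorm (s ^+ 4 * (- mu ^+ 4)) <= (S ^+ 2) ^+ 2 * m.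
  by rewrite sqnormM sqnormX -/S -exprM.
have num := sqnorm_1D_ge k0 sE.
have den := sqnorm_1D_le k0 sm.
have den0 := sqnorm_1D_ge k0 sm.
have i2 : 'i ^+ 2 = -1 :> R[i] by exact: sqr_i.
have numE : sqnorm (1 + s ^+ 4 * E s) =
    sqnorm (1 + al * s + be * s ^+ 2) * sqnorm (1 + al * ('i * s) + be * ('i * s) ^+ 2)
    * sqnorm (1 + al * (- s) + be * (- s) ^+ 2)
    * sqnorm (1 + al * (- ('i * s)) + be * (- ('i * s)) ^+ 2).
  rewrite -!sqnormM; congr sqnorm; rewrite !sqrrN exprMn i2 /E.
  have -> : (1 + al * s + be * s ^+ 2) * (1 + al * ('i * s) + be * (-1 * s ^+ 2)) *
    (1 + al * - s + be * s ^+ 2) * (1 + al * - ('i * s) + be * (-1 * s ^+ 2)) =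
    ((1 + be * s ^+ 2) ^+ 2 - al ^+ 2 * s ^+ 2) *
    ((1 - be * s ^+ 2) ^+ 2 - al ^+ 2 * s ^+ 2 * 'i ^+ 2) by ring.
  by rewrite i2; ring.
have denE : sqnorm (1 + s ^+ 4 * (- mu ^+ 4)) =
    sqnorm (1 + mu * s) * sqnorm (1 + mu * ('i * s)) * sqnorm (1 + mu * (- s))
    * sqnorm (1 + mu * (- ('i * s))).
  rewrite -!sqnormM; congr sqnorm.
  have -> : (1 + mu * s) * (1 + mu * ('i * s)) * (1 + mu * - s) * (1 + mu * - ('i * s)) =
    (1 - mu ^+ 2 * s ^+ 2) * (1 - mu ^+ 2 * s ^+ 2 * 'i ^+ 2) by ring.
  by rewrite i2; ring.
have hs := gh s sr.
have his : g 0 * sqnorm (1 + al * ('i * s) + be * ('i * s) ^+ 2) <=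
    g ('i * s) * sqnorm (1 + mu * ('i * s)) by apply: gh; rewrite sqnormi.
have hns : g 0 * sqnorm (1 + al * (- s) + be * (- s) ^+ 2) <=
    g (- s) * sqnorm (1 + mu * (- s)) by apply: gh; rewrite sqnormN.
have hnis : g 0 * sqnorm (1 + al * (- ('i * s)) + be * (- ('i * s)) ^+ 2) <=
    g (- ('i * s)) * sqnorm (1 + mu * (- ('i * s))).
  by apply: gh; rewrite sqnormN sqnormi.
have prod : g 0 ^+ 4 * sqnorm (1 + s ^+ 4 * E s) <=
    g s * g ('i * s) * g (- s) * g (- ('i * s)) * sqnorm (1 + s ^+ 4 * (- mu ^+ 4)).
  rewrite numE denE.
  have := ler_pM _ _ (ler_pM _ _ (ler_pM _ _ hs his) hns) hnis.
  rewrite !mulr_ge0 ?sqnorm_ge0 ?(ltW g00) // => /(_ isT isT isT isT isT isT) h.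
  by apply: le_trans (le_trans h _); rewrite le_eqVlt; apply/orP; left; apply/eqP; ring.
have dpos : 0 < sqnorm (1 + s ^+ 4 * (- mu ^+ 4)).
  apply: lt_le_trans den0; rewrite subr_gt0.
  apply: le_lt_trans SC; rewrite expr2 -mulrA ler_pM2l // /C.
  have := ler_wpM2r (addr_ge0 ler01 m0) (ltW S1).
  by lra.
rewrite -(ler_pM2r dpos); apply: le_trans prod.
rewrite -mulrA ler_pM2l ?exprn_gt0 //.
apply: le_trans num.
have h1 : 0 <= 1 - eta * S by rewrite subr_ge0 mulrC ltW.
apply: le_trans (ler_wpM2l h1 den) _.
have S2 : S ^+ 2 <= S by rewrite expr2 ler_piMr // ltW.
have h2 : S * (S * C) <= S * eta by rewrite ler_pM2l // ltW.
have h3 : (S ^+ 2) ^+ 2 * m <= S ^+ 2 * m.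
  apply: ler_wpM2r => //; rewrite expr2 ler_piMr ?(ltW k0) //.
  exact: le_trans S2 (ltW S1).
have h4 : 0 <= eta * S * (S ^+ 2 * (1 + m) + (S ^+ 2) ^+ 2 * m).
  apply: mulr_ge0; first by rewrite mulr_ge0 ?(ltW S0) ?(ltW eta0).
  apply: addr_ge0; apply: mulr_ge0; rewrite ?sqr_ge0 //.
  exact: addr_ge0 ler01 m0.
rewrite /C in h2; have := ltW k0; nra.
Qed.

End Touching.

(** * Cauchy-Schwarz inequality and sums of squared moduli *)

Section CauchySchwarz.
Context {R : realType} {n : nat}.
Implicit Types (X Y b : 'rV[R[i]]_n).

Definition dot Y X : R[i] := \sum_j Y 0 j * (X 0 j)^*.

Lemma dotD Y Z X : dot (Y + Z) X = dot Y X + dot Z X.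
Proof. by rewrite /dot -big_split; apply: eq_bigr => j _; rewrite mxE mulrDl. Qed.

Lemma dotZ a Y X : dot (a *: Y) X = a * dot Y X.
Proof. by rewrite /dot mulr_sumr; apply: eq_bigr => j _; rewrite mxE mulrA. Qed.

Lemma dotXX X : dot X X = (N2 X)%:C.
Proof.
rewrite /dot /N2 (raddf_sum (real_complex R)); apply: eq_bigr => j _.
by case: (X 0 j) => x y; apply/eqP; rewrite eq_complex /sqnorm /=; apply/andP; split;
  apply/eqP; ring.
Qed.

Lemma N2B_dot Y X (t : R[i]) :
  N2 (Y - t *: X) = N2 Y - 2 * Re (t^* * dot Y X) + sqnorm t * N2 X.
Proof.
rewrite /N2 /dot !mulr_sumr (raddf_sum (@complex.Re R)) mulr_sumr -sumrB -big_split.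
apply: eq_bigr => j _; rewrite !mxE; case: t (Y 0 j) (X 0 j) => [a b] [c d] [e f].
by rewrite /sqnorm /=; ring.
Qed.

(** Expand the nonnegative quadratic A |y - t x|^2 + k |Y - t X|^2 at its minimiser t = Phi / G. *)
Lemma weighted_cauchy_schwarz (A k : R) (x y : R[i]) X Y : 0 <= A -> 0 <= k ->
  0 < A * sqnorm x + k * N2 X ->
  sqnorm (A%:C * (y * x^*) + k%:C * dot Y X) <=
  (A * sqnorm x + k * N2 X) * (A * sqnorm y + k * N2 Y).
Proof.
move=> A0 k0; set G := (X in 0 < X) => G0.
set Phi := _ + _; set H := (X in _ * X).
pose t := (G^-1)%:C * Phi.
have : 0 <= A * sqnorm (y - t * x) + k * N2 (Y - t *: X).
  by rewrite addr_ge0 // mulr_ge0 ?sqnorm_ge0 ?N2_ge0.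
have -> : A * sqnorm (y - t * x) + k * N2 (Y - t *: X) =
    H - 2 * Re (t^* * Phi) + sqnorm t * G.
  rewrite N2B_dot /H /G /Phi.
  have id (t' x' y' p : R[i]) (a b : R) :
      A * sqnorm (y' - t' * x') + k * (b - 2 * Re (t'^* * p) + sqnorm t' * a) =
      A * sqnorm y' + k * b - 2 * Re (t'^* * (A%:C * (y' * x'^*) + k%:C * p)) +
      sqnorm t' * (A * sqnorm x' + k * a).
    case: t' x' y' p => [t1 t2] [x1 x2] [y1 y2] [p1 p2].
    by rewrite /sqnorm /=; ring.
  exact: id.
have -> : Re (t^* * Phi) = G^-1 * sqnorm Phi.
  have id (p : R[i]) (a : R) : Re ((a%:C * p)^* * p) = a * sqnorm p.
    by case: p => p1 p2; rewrite /sqnorm /=; ring.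
  exact: id.
rewrite /t sqnormM sqnorm_real => h.
rewrite -subr_ge0; have := mulr_ge0 (ltW G0) h.
have id (a b c : R) : a != 0 ->
    a * (b - 2 * (a^-1 * c) + (a^-1) ^+ 2 * c * a) = a * b - c by move=> a0; field.
by rewrite id ?gt_eqF.
Qed.

(* By Cauchy-Schwarz, a sum of squares |g_k|^2 of holomorphic functions is bounded
   below by |sum_k conj(g_k(0)) g_k|^2 / sum_k |g_k(0)|^2, with equality at 0. *)
Lemma submean_sum_squares (A k : R) (l be d : R[i]) X b :
  0 <= A -> 0 <= k -> d != 0 ->
  let G (s : R[i]) := A * (sqnorm (l + s * be) / sqnorm (d + s * be)) + k * N2 (X + s
    *: b) in
  0 < G 0 -> exists al ga mu : R[i], exists2 r : R, 0 < r & forall s, sqnorm s < r ->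
    G 0 * sqnorm (1 + al * s + ga * s ^+ 2) <= G s * sqnorm (1 + mu * s).
Proof.
move=> A0 k0 d0 G G0.
(* Dividing by d normalises the denominator to 1 + mu s. *)
pose mu := be / d; pose x := l / d.
have GE s : 1 + mu * s != 0 ->
    G s = A * sqnorm ((x + mu * s) / (1 + mu * s)) + k * N2 (X + s *: b).
  move=> ms; rewrite /G.
  have -> : l + s * be = d * (x + mu * s) by rewrite /x /mu; field.
  have -> : d + s * be = d * (1 + mu * s) by rewrite /mu; field.
  rewrite !sqnormM sqnormV; congr (A * _ + _); rewrite -mulf_div divff ?mul1r //.
  by rewrite sqnorm_eq0.
have G0E : G 0 = A * sqnorm x + k * N2 X.
  by rewrite GE ?mulr0 ?addr0 ?oner_eq0 // divr1 scale0r addr0.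
pose g0 : R[i] := (G 0)%:C.
have g00 : g0 != 0 by rewrite -sqnorm_eq0 sqnorm_real expf_neq0 // gt_eqF.
pose B := k%:C * dot b X.
(* [al] and [ga] are read off from the coefficients of s and s^2 in the quadratic polynomial Phi (1
   + mu s), whose constant term is g0. *)
pose al := (A%:C * x^* * mu + mu * (k * N2 X)%:C + B) / g0.
pose ga := mu * B / g0.
exists al, ga, mu, (sqnorm mu + 1)^-1.
  by rewrite invr_gt0 ltr_wpDl ?sqnorm_ge0.
move=> s sr.
have ms : 1 + mu * s != 0.
  apply/eqP => ms; have : mu * s = -1 by apply/eqP; rewrite -addr_eq0 addrC ms.
  move=> /(congr1 (@sqnorm R)); rewrite sqnormM sqnormN.
  have -> : sqnorm (1 : R[i]) = 1 by rewrite /sqnorm /= expr1n expr0n addr0.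
  move: sr; rewrite -[_^-1]mul1r ltr_pdivlMr ?ltr_wpDl ?sqnorm_ge0 //.
  by have := sqnorm_ge0 s; rewrite mulrDr mulr1 mulrC; lra.
have ms0 : 0 < sqnorm (1 + mu * s) by rewrite lt_neqAle eq_sym sqnorm_eq0 ms sqnorm_ge0.
have := @weighted_cauchy_schwarz A k x ((x + mu * s) / (1 + mu * s)) X (X + s *: b) A0 k0.
rewrite -G0E -GE // => /(_ G0).
set Phi := A%:C * _ + _ => h.
have PhiE : Phi * (1 + mu * s) = g0 * (1 + al * s + ga * s ^+ 2).
  have e1 : g0 * al = A%:C * x^* * mu + mu * (k * N2 X)%:C + B by rewrite mulrC divfK.
  have e2 : g0 * ga = mu * B by rewrite mulrC divfK.
  have e0 : g0 = A%:C * (x * x^*) + (k * N2 X)%:C.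
    rewrite /g0 G0E rmorphD rmorphM; congr (_ * _ + _).
    by case: (x) => a c; apply/eqP; rewrite eq_complex /sqnorm /=; apply/andP; split;
      apply/eqP; ring.
  have -> : g0 * (1 + al * s + ga * s ^+ 2) = g0 + (g0 * al) * s + (g0 * ga) * s ^+ 2.
    by ring.
  rewrite e1 e2 e0 /Phi dotD dotZ dotXX /B !rmorphM.
  have id (u v c w a p m' : R[i]) : 1 + m' * s != 0 ->
      (u * ((v + m' * s) / (1 + m' * s) * c) + a * (w + s * p)) * (1 + m' * s) =
      u * (v * c) + a * w + (u * c * m' + m' * (a * w) + a * p) * s + m' * (a * p) * s
        ^+ 2.
    by move=> m0; field.
  exact: id.
have G0s : 0 < G 0 ^+ 2 by rewrite exprn_gt0.
have g0s : sqnorm g0 = G 0 ^+ 2 by rewrite sqnorm_real.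
rewrite -(ler_pM2l G0) mulrA -expr2 -g0s -sqnormM -PhiE sqnormM mulrA.
by rewrite ler_pM2r.
Qed.

End CauchySchwarz.

Section Power.
Context {R : realType}.
Implicit Types (g : R[i] -> R).

(** With y = eta |s|^2 / 2, multiply the inequality by its own power of exponent sig. The factor (1
    - y)^(1 + sig) is at least (1 - y)^2 >= 1 - 2y because sig <= 1. *)
Lemma local_log_submean_power g (sig : R) x : 0 <= sig <= 1 ->
  (forall y, 0 <= g y) -> local_log_submean g x ->
  local_log_submean (fun y => g y * g y `^ sig) x.
Proof.
move=> /andP[s0 s1] g0 lg eta eta0.
have [r r0 rg] := lg _ (divr_gt0 eta0 (ltr0n _ 2)).
exists (Num.min r eta^-1); first by rewrite lt_min r0 invr_gt0.
move=> s; rewrite lt_min => /andP[/rg h se].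
set y := eta / 2 * sqnorm s in h.
have y0 : 0 <= y by rewrite mulr_ge0 ?sqnorm_ge0 // ltW ?divr_gt0.
have y2 : y < 2^-1.
  by move: se; rewrite -[eta^-1]mul1r ltr_pdivlMr // /y; lra.
have y1 : 0 < 1 - y by rewrite subr_gt0 (lt_trans y2) // invf_lt1 ?ltr1n.
have yp : 1 - y <= (1 - y) `^ sig.
  by apply: ger1_powR => //; rewrite y1 /=; lra.
set P := (X in _ <= X) in h.
have P0 : 0 <= P by rewrite /P !mulr_ge0.
have X0 : 0 <= g x ^+ 4 * (1 - y) by rewrite mulr_ge0 ?exprn_ge0 // ltW.
have := ler_pM X0 (powR_ge0 _ sig) h (ge0_ler_powR s0 X0 P0 h).
have -> : (g x ^+ 4 * (1 - y)) `^ sig = (g x `^ sig) ^+ 4 * (1 - y) `^ sig.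
  rewrite powRM ?exprn_ge0 ?(ltW y1) //; congr (_ * _).
  by rewrite -(powR_mulrn 4 (g0 x)) -(powR_mulrn 4 (powR_ge0 _ _)) -!powRrM mulrC.
have -> : P `^ sig = (g (x + s) `^ sig) * (g (x + 'i * s) `^ sig)
   * (g (x - s) `^ sig) * (g (x - 'i * s) `^ sig) by rewrite /P !powRM ?mulr_ge0.
move=> h1.
set Q := (X in _ <= X); have -> : Q = P * ((g (x + s) `^ sig) * (g (x + 'i * s) `^ sig)
   * (g (x - s) `^ sig) * (g (x - 'i * s) `^ sig)) by rewrite /Q /P; ring.
apply: le_trans h1.
have h2 : 1 - eta * sqnorm s <= (1 - y) * (1 - y) `^ sig.
  have : (1 - y) * (1 - y) <= (1 - y) * (1 - y) `^ sig by rewrite ler_pM2l.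
  apply: le_trans; have -> : eta * sqnorm s = 2 * y by rewrite /y; field.
  by have := sqr_ge0 y; lra.
set G := g x ^+ 4; set F := (g x `^ sig) ^+ 4; move: ((1 - y) `^ sig) h2 => Z h2.
have -> : G * (1 - y) * (F * Z) = G * F * ((1 - y) * Z) by ring.
have -> : (g x * g x `^ sig) ^+ 4 = G * F by rewrite exprMn.
by apply: ler_wpM2l => //; rewrite mulr_ge0 ?exprn_ge0 ?powR_ge0.
Qed.

End Power.

(** * The competitor for the Sibony metric *)

Section LinearForms.
Context {R : realType} {n : nat}.
Implicit Types (w z X Y : 'rV[R[i]]_n) (lam : 'cV[R[i]]_n).

Definition lin lam X : R[i] := (X *m lam) 0 0.

Lemma linD lam X Y : lin lam (X + Y) = lin lam X + lin lam Y.
Proof. by rewrite /lin mulmxDl mxE. Qed.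

Lemma linB lam X Y : lin lam (X - Y) = lin lam X - lin lam Y.
Proof. by rewrite /lin mulmxBl !mxE. Qed.

Lemma linZ lam a X : lin lam (a *: X) = a * lin lam X.
Proof. by rewrite /lin -scalemxAl mxE. Qed.

Lemma sqnorm_lin_le lam : exists2 C : R, 0 < C & forall X, sqnorm (lin lam X) <= C * N2 X.
Proof.
pose mu : 'rV[R[i]]_n := \row_j Num.conj (lam j 0).
have linE X : lin lam X = dot X mu.
  by rewrite /lin mxE; apply: eq_bigr => j _; rewrite /mu mxE conjCK.
exists (N2 mu + 1); first by rewrite ltr_wpDl ?N2_ge0.
move=> X; rewrite linE.
have [mu0|mu0] := eqVneq (N2 mu) 0.
  rewrite /dot big1 ?sqnorm0 ?mulr_ge0 ?addr_ge0 ?N2_ge0 // => j _.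
  have /eqP : sqnorm (mu 0 j) = 0.
    by apply/le_anti; rewrite sqnorm_ge0 andbT -mu0 le_N2.
  by rewrite sqnorm_eq0 => /eqP ->; rewrite conjC0 mulr0.
have := @weighted_cauchy_schwarz R n 0 1 0 0 mu X (lexx 0) ler01.
rewrite sqnorm0 !mulr0 !mul0r !add0r !mul1r.
have m0 : 0 < N2 mu by rewrite lt_neqAle eq_sym mu0 N2_ge0.
by move=> /(_ m0) /le_trans; apply; rewrite mulrDl lerDl mul1r N2_ge0.
Qed.

Lemma lipschitz_continuous (f : 'rV[R[i]]_n -> R[i]) (C : R) : 0 < C ->
  (forall y w, sqnorm (f y - f w) <= C * N2 (y - w)) -> continuous f.
Proof.
move=> C0 fC w A /nbhs_sqnormP[e e0 eA]; apply/nbhs_N2P.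
exists (e / C); first by rewrite divr_gt0.
move=> y yw; apply: eA; apply: le_lt_trans (fC _ _) _.
by rewrite mulrC -ltr_pdivlMr.
Qed.

Lemma coord_sub_continuous z j : continuous (fun w => (w - z) 0 j).
Proof.
apply: (lipschitz_continuous ltr01) => y w; rewrite mul1r.
apply: le_trans (le_N2 _ j); rewrite !mxE opprB addrA subrK.
by [].
Qed.

Lemma lin_sub_continuous lam z (c : R[i]) : continuous (fun w => lin lam (w - z) - c).
Proof.
have [C C0 lC] := sqnorm_lin_le lam.
apply: (lipschitz_continuous C0) => y w.
by apply: le_trans (lC _); rewrite le_eqVlt; apply/orP; left; apply/eqP; congr sqnorm;
  rewrite !linB; ring.
Qed.

Lemma N2_sub_continuous z : continuous (fun w => N2 (w - z)).
Proof.
have h (s : seq 'I_n) : continuous (fun w => \sum_(j <- s) sqnorm ((w - z) 0 j)).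
  elim: s => [|j s IH] w.
    rewrite (_ : (fun w => _) = fun=> 0); first exact: cst_continuous.
    by apply/funext => y; rewrite big_nil.
  rewrite (_ : (fun w => _) = fun w =>
    sqnorm ((w - z) 0 j) + \sum_(j <- s) sqnorm ((w - z) 0 j)); last first.
    by apply/funext => y; rewrite big_cons.
  have hj := @continuous_comp _ _ _ _ _ w (@coord_sub_continuous z j w)
    (@sqnorm_continuous R _).
  exact: (cvgD hj (IH w)).
exact: h.
Qed.

Lemma sqnorm_lin_sub_continuous lam z (c : R[i]) :
  continuous (fun w => sqnorm (lin lam (w - z) - c)).
Proof.
move=> w; exact: (@continuous_comp _ _ _ _ _ w
  (@lin_sub_continuous lam z c w) (@sqnorm_continuous R _)).
Qed.

Lemma near_eq_continuous (f g : 'rV[R[i]]_n -> R) w : {for w, continuous g} ->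
  (\forall y \near w, g y = f y) -> {for w, continuous f}.
Proof.
move=> cg gf; rewrite /prop_for /continuous_at -(nbhs_singleton gf).
by apply: cvg_trans cg; exact: (near_eq_cvg gf).
Qed.

End LinearForms.

(* For x < 0 the library's power [x `^ s] is 1, whence the case distinction. *)
Lemma mulr_powR_continuous {R : realType} (s q : R) : 0 <= s -> 0 <= q ->
  {for q, continuous (fun x : R => x * x `^ s)}.
Proof.
move=> s0; rewrite le_eqVlt => /predU1P[<-|q0]; last first.
  have cq : {for q, continuous (fun x : R => x * expR (s * ln x))}.
    apply: cvgM; first exact: cvg_id.
    apply: (@continuous_comp _ _ _ (fun x => s * ln x) expR); last exact: continuous_expR.
    by apply: cvgM; [exact: cvg_cst|exact: continuous_ln].
  rewrite /prop_for /continuous_at.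
  have e : \forall x \near q, x * expR (s * ln x) = x * x `^ s.
    near=> x; have x0 : 0 < x by near: x; exact: lt_nbhsr.
    by rewrite /powR gt_eqF.
  rewrite -(nbhs_singleton e).
  by apply: cvg_trans cq; exact: near_eq_cvg.
rewrite /prop_for /continuous_at mul0r.
have n0 : `|x| @[x --> (0 : R)] --> (0 : R).
  by rewrite -[X in _ --> X](normr0 R); apply: cvg_norm; exact: cvg_id.
have n1 : - `|x| @[x --> (0 : R)] --> (0 : R).
  by rewrite -[X in _ --> X]oppr0; exact: cvgN.
apply: (squeeze_cvgr _ n1 n0).
near=> x; rewrite -ler_norml normrM ler_piMr // ger0_norm ?powR_ge0 //.
have [x0|x0] := ltP 0 x.
  have x1 : x <= 1 by near: x; exact: (cvgr_le _ (@cvg_id _ (nbhs (0 : R))) _ ltr01).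
  have := @ge0_ler_powR R s s0 x 1; rewrite !nnegrE ler01 powR1 ltW //.
  exact.
move: x0; rewrite le_eqVlt => /predU1P[->|x0].
  by rewrite /powR eqxx; case: (s == 0).
by rewrite /powR lt_eqF // ln0 ?mulr0 ?expR0 // ltW.
Unshelve. all: by end_near.
Qed.

(** * The glued competitor: bounds, continuity and logarithmic submean property *)

Section Candidate.
Context {R : realType} {n : nat}.
Context (z : 'rV[R[i]]_n) (lam : 'cV[R[i]]_n) (tau rad rho sig : R).
Implicit Types (w X : 'rV[R[i]]_n).

Definition inner w : R :=
  rho ^+ 2 / (4 * rad ^+ 2) *
    (sqnorm (lin lam (w - z)) / sqnorm (lin lam (w - z) - (4 * tau)%:C))
  + (4 * rad ^+ 2)^-1 * N2 (w - z).

Definition relsize w : R := N2 (w - z) / rad ^+ 2.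
Definition outer w : R := relsize w * relsize w `^ sig.

(* [inner] is v1 and [outer] is v2. *)
Definition candidate w : R :=
  if N2 (w - z) < rho ^+ 2 then Num.max (inner w) (outer w) else outer w.

Context (D : set 'rV[R[i]]_n) (tau0 : 0 < tau) (rho0 : 0 < rho) (rad0 : 0 < rad)
  (sig01 : 0 < sig <= 1) (sigE : (rho ^+ 2 / rad ^+ 2) `^ sig = 2^-1)
  (oD : open D)
  (Drad : forall w, D w -> N2 (w - z) < rad ^+ 2)
  (Dslab : forall w, D w -> N2 (w - z) <= rho ^+ 2 -> Re (lin lam (w - z)) <= 2 * tau).

Let rad2 : 0 < rad ^+ 2. Proof. by rewrite exprn_gt0. Qed.
Let rho2 : 0 < rho ^+ 2. Proof. by rewrite exprn_gt0. Qed.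
(** The value of v2 on the sphere |w - z| = rho, by the choice of sig, and an upper bound of v1 on
    the part of the closed ball in D. *)
Let edge : R := rho ^+ 2 / (2 * rad ^+ 2).

Lemma relsize_ge0 w : 0 <= relsize w.
Proof. by rewrite divr_ge0 ?N2_ge0 // ltW. Qed.

Lemma outer_ge0 w : 0 <= outer w.
Proof. by rewrite mulr_ge0 ?relsize_ge0 ?powR_ge0. Qed.

Lemma candidate_ge_outer w : outer w <= candidate w.
Proof. by rewrite /candidate; case: ifP => // _; rewrite le_max lexx orbT. Qed.

Lemma candidate_ge0 w : 0 <= candidate w.
Proof. exact: le_trans (outer_ge0 w) (candidate_ge_outer w). Qed.

Lemma pole_avoided w : D w -> N2 (w - z) <= rho ^+ 2 ->
  lin lam (w - z) - (4 * tau)%:C != 0.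
Proof.
move=> Dw wr; have := Dslab Dw wr; apply: contraTneq => /eqP.
by rewrite subr_eq0 => /eqP -> /=; rewrite -ltNge; have := tau0; lra.
Qed.

(** Re l <= 2 tau says that l is no farther from 0 than from the pole 4 tau, so |f| <= 1; each of
    the two terms is then at most half of [edge]. *)
Lemma inner_le_edge w : D w -> N2 (w - z) <= rho ^+ 2 -> inner w <= edge.
Proof.
move=> Dw wr; have := Dslab Dw wr; have := pole_avoided Dw wr.
rewrite -sqnorm_eq0; set l := lin _ _ => l0 ls.
have l0' : 0 < sqnorm (l - (4 * tau)%:C) by rewrite lt_neqAle eq_sym l0 sqnorm_ge0.
have f1 : sqnorm l / sqnorm (l - (4 * tau)%:C) <= 1.
  rewrite ler_pdivrMr // mul1r; move: ls tau0; case: (l) => a b; rewrite /sqnorm /= subr0.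
  by nra.
have -> : edge = rho ^+ 2 / (4 * rad ^+ 2) * 1 + (4 * rad ^+ 2)^-1 * rho ^+ 2.
  by rewrite /edge; field; rewrite gt_eqF.
have r4 : 0 < 4 * rad ^+ 2 by rewrite mulr_gt0.
by rewrite lerD // ler_wpM2l // ?invr_ge0 ?divr_ge0 // ltW.
Qed.

Lemma outer_lt1 w : D w -> outer w < 1.
Proof.
move=> Dw; have q1 : relsize w < 1 by rewrite ltr_pdivrMr // mul1r Drad.
apply: le_lt_trans q1; rewrite ler_piMr ?relsize_ge0 //.
case/andP: sig01 => s0 _.
have := @ge0_ler_powR R sig (ltW s0) (relsize w) 1.
rewrite !nnegrE relsize_ge0 ler01 powR1; apply => //.
by rewrite ler_pdivrMr // mul1r ltW // Drad.
Qed.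

Context (rho_rad : rho ^+ 2 < rad ^+ 2).

Lemma candidate_lt1 w : D w -> candidate w < 1.
Proof.
move=> Dw; rewrite /candidate; case: ifPn => [wr|_]; last exact: outer_lt1.
rewrite gt_max outer_lt1 // andbT; apply: le_lt_trans (inner_le_edge Dw (ltW wr)) _.
by rewrite /edge ltr_pdivrMr ?mulr_gt0 //; have := rad2; have := rho_rad; lra.
Qed.

Lemma inner_continuous w : D w -> N2 (w - z) <= rho ^+ 2 -> {for w, continuous inner}.
Proof.
move=> Dw wr.
have c1 : {for w, continuous (fun w => sqnorm (lin lam (w - z)))}.
  rewrite (_ : (fun w => _) = fun w => sqnorm (lin lam (w - z) - 0)).
    exact: sqnorm_lin_sub_continuous.
  by apply/funext => y; rewrite subr0.
have c2 := @sqnorm_lin_sub_continuous R n lam z (4 * tau)%:C w.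
have c3 := @N2_sub_continuous R n z w.
have p0 : sqnorm (lin lam (w - z) - (4 * tau)%:C) != 0.
  by rewrite sqnorm_eq0 pole_avoided.
exact: (cvgD (cvgM (cvg_cst _) (cvgM c1 (cvgV p0 c2))) (cvgM (cvg_cst _) c3)).
Qed.

Lemma outer_continuous w : {for w, continuous outer}.
Proof.
have c : {for w, continuous relsize}.
  exact: (cvgM (@N2_sub_continuous R n z w) (cvg_cst _)).
apply: (@continuous_comp _ _ _ relsize (fun x => x * x `^ sig)) => //.
by apply: mulr_powR_continuous; rewrite ?relsize_ge0 // ltW //; case/andP: sig01.
Qed.

(** Only the sphere |w - z| = rho is delicate. Near it the competitor lies between v2 and max(v2,
    [edge]), and both tend to [edge]. *)
Lemma candidate_continuous w : D w -> {for w, continuous candidate}.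
Proof.
move=> Dw; have co := @outer_continuous w.
have cN := @N2_sub_continuous R n z w.
have [wr|wr|wr] := ltgtP (N2 (w - z)) (rho ^+ 2).
- apply: (@near_eq_continuous _ _ _ (fun y => Num.max (inner y) (outer y))).
    by apply: cvg_maxr co; exact: inner_continuous (ltW wr).
  near=> y; rewrite /candidate ifT //; near: y; exact: cvgr_lt cN _ wr.
- apply: (@near_eq_continuous _ _ _ outer) => //.
  near=> y; rewrite /candidate ifF //; apply/negbTE; rewrite -leNgt.
  near: y; exact: cvgr_ge cN _ wr.
have oE : outer w = edge.
  by rewrite /outer /relsize wr sigE /edge; field; rewrite gt_eqF.
have cE : candidate w = edge by rewrite /candidate wr ltxx.
rewrite /prop_for /continuous_at cE.
have c1 : outer y @[y --> w] --> edge by rewrite -oE.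
have c2 : Num.max (outer y) edge @[y --> w] --> edge.
  by rewrite -[X in _ --> X](maxxx edge); exact: (cvg_maxr c1 (cvg_cst _)).
apply: (squeeze_cvgr _ c1 c2).
have Dn : \forall y \near w, D y by exact: open_nbhs_nbhs.
apply: filterS Dn => y Dy; rewrite candidate_ge_outer /candidate.
case: ifPn => [yr|_]; last by rewrite le_max lexx.
by rewrite ge_max !le_max lexx (inner_le_edge Dy (ltW yr)) orbT.
Unshelve. all: by end_near.
Qed.

Lemma relsize_log_submean (a b : 'rV[R[i]]_n) : 0 < relsize a ->
  local_log_submean (fun s => relsize (a + s *: b)) 0.
Proof.
move=> a0; have r2 : 0 <= (rad ^+ 2)^-1 by rewrite invr_ge0 ltW.
have GE s : relsize (a + s *: b) =
    0 * (sqnorm (0 + s * 0) / sqnorm (1 + s * 0)) + (rad ^+ 2)^-1 * N2 (a - z + s *: b).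
  by rewrite mul0r add0r /relsize mulrC addrAC.
(* The weight 0 removes the quotient term, whose denominator is taken to be the constant 1. *)
have := @submean_sum_squares R n 0 (rad ^+ 2)^-1 0 0 1 (a - z) b (lexx 0) r2
  (oner_neq0 _).
cbv zeta beta; rewrite -(GE 0) scale0r addr0 => /(_ a0) [al [ga [mu [r r0 h]]]].
apply: (@log_submean_touching _ _ al ga mu r) => //.
- by rewrite scale0r addr0.
- by move=> s; exact: relsize_ge0.
- by move=> s sr; rewrite scale0r addr0 GE; exact: h.
Qed.

(** The competitor is at least v1 near a and equals v1 at a, so the rational lower bound that
    touches v1 at a also touches the competitor. *)
Lemma inner_log_submean (a b : 'rV[R[i]]_n) : D a -> N2 (a - z) < rho ^+ 2 ->
  0 < inner a -> outer a <= inner a ->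
  local_log_submean (fun s => candidate (a + s *: b)) 0.
Proof.
move=> Da ar a0 oi; have r2 : 0 <= (4 * rad ^+ 2)^-1 by rewrite invr_ge0 mulr_ge0 ?ltW.
have A0 : 0 <= rho ^+ 2 / (4 * rad ^+ 2) := mulr_ge0 (ltW rho2) r2.
have d0 := pole_avoided Da (ltW ar).
have := @submean_sum_squares R n _ _ (lin lam (a - z)) (lin lam b) _ (a - z) b A0 r2 d0.
have GE s : inner (a + s *: b) = rho ^+ 2 / (4 * rad ^+ 2) *
   (sqnorm (lin lam (a - z) + s * lin lam b) /
    sqnorm (lin lam (a - z) - (4 * tau)%:C + s * lin lam b)) +
    (4 * rad ^+ 2)^-1 * N2 (a - z + s *: b).
  by rewrite /inner [a + _ - z]addrAC (linD lam (a - z)) linZ [_ - (4 * tau)%:C +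
    _]addrAC.
cbv zeta beta; rewrite -(GE 0) scale0r addr0 => /(_ a0) [al [ga [mu [r r0 h]]]].
have ca : candidate a = inner a by rewrite /candidate ar max_l.
have : \forall s \near (0 : R[i]), N2 (a + s *: b - z) < rho ^+ 2.
  have := @continuous_comp _ _ _ _ _ (0 : R[i]) (@affine_disc_continuous R n a b 0)
    (@N2_sub_continuous R n z _).
  by move=> c; apply: (cvgr_lt _ c); rewrite /= scale0r addr0.
move=> /nbhs_sqnormP[r1 r10 near_a].
apply: (@log_submean_touching _ _ al ga mu (Num.min r r1)).
- by rewrite scale0r addr0 ca.
- by rewrite lt_min r0.
- by move=> s; exact: candidate_ge0.
- move=> s; rewrite lt_min => /andP[sr sr1]; rewrite scale0r addr0 ca.
  apply: le_trans (h s sr) _; rewrite -GE ler_wpM2r ?sqnorm_ge0 //.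
  by rewrite /candidate near_a ?subr0 // le_max lexx.
Qed.

(** If v1 is not the active function at a, the competitor equals v2 at a and is at least v2
    everywhere; the inequality for v2, a power of |w - z|^2 up to scaling, therefore passes to
    it. *)
Lemma candidate_log_submean (a b : 'rV[R[i]]_n) : D a -> 0 < candidate a ->
  local_log_submean (fun s => candidate (a + s *: b)) 0.
Proof.
move=> Da; case: (boolP ((N2 (a - z) < rho ^+ 2) && (outer a <= inner a))).
  move=> /andP[ar oi]; rewrite /candidate ar max_l // => a0.
  exact: inner_log_submean.
move=> no; have ca : candidate a = outer a.
  move: no; rewrite /candidate negb_and; case: ifP => //= _.
  by rewrite -ltNge => io; rewrite max_r // ltW.
rewrite ca => a0; have q0 : 0 < relsize a.
  rewrite lt_neqAle relsize_ge0 andbT; apply: contraTneq a0 => q0.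
  by rewrite /outer -q0 mul0r ltxx.
have s01 : 0 <= sig <= 1 by case/andP: sig01 => /ltW -> ->.
have := @local_log_submean_power _ _ sig 0 s01 _ (@relsize_log_submean a b q0).
move=> /(_ (fun s => relsize_ge0 _)) lo eta eta0.
have [r r0 h] := lo _ eta0; exists r => // s sr.
have := h s sr; rewrite !scale0r !addr0 => h1.
rewrite ca; apply: le_trans h1 _.
have o := candidate_ge_outer; have p := outer_ge0.
exact: (ler_pM (mulr_ge0 (mulr_ge0 (p _) (p _)) (p _)) (p _)
  (ler_pM (mulr_ge0 (p _) (p _)) (p _) (ler_pM (p _) (p _) (o _) (o _)) (o _)) (o _)).
Qed.

End Candidate.

(** * The Levi form of the competitor *)

Section Smooth.
Context {R : realType} {n : nat}.
Implicit Types (f g : 'rV[R[i]]_n -> R) (w e a : 'rV[R[i]]_n) (V : set 'rV[R[i]]_n).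

Definition line_derive f e w (d : R) : Prop :=
  is_derive (0 : R) (1 : R) (on_real_line f e w) d.

Lemma on_real_line0 f e w : on_real_line f e w 0 = f w.
Proof. by rewrite /on_real_line scale0r addr0. Qed.

Lemma partialE f j b w d : line_derive f (real_dir j b) w d -> partial f j b w = d.
Proof. by case=> _ <-; rewrite /partial derive1E. Qed.

Lemma line_near V e w : open V -> V w -> \forall t \near (0 : R), V (w + t%:C *: e).
Proof.
move=> oV Vw; have : nbhs w V by exact: open_nbhs_nbhs.
move=> /nbhs_N2P[r r0 rV].
have q0 : 0 < r / (N2 e + 1) by rewrite divr_gt0 // ltr_wpDl ?N2_ge0.
have c : (fun t : R => t * t) t @[t --> (0 : R)] --> (0 : R) * 0.
  by apply: cvgM; exact: cvg_id.
rewrite mulr0 in c.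
have : \forall t \near (0 : R), t * t < r / (N2 e + 1) by exact: (cvgr_lt _ c _ q0).
apply: filterS => t tq; apply: rV.
rewrite addrAC subrr add0r N2Z sqnorm_real expr2.
move: tq; rewrite ltr_pdivlMr ?ltr_wpDl ?N2_ge0 //; apply: le_lt_trans.
by rewrite ler_wpM2l ?lerDl // -expr2 sqr_ge0.
Qed.

Lemma eq_line_derive V f g e w d : open V -> V w ->
  (forall y, V y -> f y = g y) -> line_derive f e w d -> line_derive g e w d.
Proof.
move=> oV Vw fg; apply: near_eq_is_derive.
by have := line_near e oV Vw; apply: filterS => t; exact: fg.
Qed.

Lemma line_deriveD f g e w df dg : line_derive f e w df -> line_derive g e w dg ->
  line_derive (fun y => f y + g y) e w (df + dg).
Proof. by move=> hf hg; exact: is_deriveD. Qed.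

Lemma line_deriveM f g e w df dg : line_derive f e w df -> line_derive g e w dg ->
  line_derive (fun y => f y * g y) e w (f w * dg + g w * df).
Proof.
move=> hf hg; rewrite -[X in X * dg](on_real_line0 f e) -[X in X * df](on_real_line0 g e).
exact: is_deriveM.
Qed.

Lemma line_deriveV f e w df : f w != 0 -> line_derive f e w df ->
  line_derive (fun y => (f y)^-1) e w (- (f w) ^- 2 * df).
Proof.
move=> f0 hf; have f0' : on_real_line f e w 0 != 0 by rewrite on_real_line0.
rewrite -(on_real_line0 f e); exact: (is_deriveV f0' hf).
Qed.

Lemma line_derive_affine f e w (c : R) :
  (forall t : R, f (w + t%:C *: e) = f w + t * c) -> line_derive f e w c.
Proof.
move=> fE; rewrite /line_derive (_ : on_real_line f e w = fun t => f w + t * c).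
  by apply: is_derive_eq; rewrite scaler0 !add0r mul1r -[RHS]mulr1.
by apply/funext => t; rewrite /on_real_line fE.
Qed.

(** The first derivatives are supplied as a witness [g], so that closure under sums, products and
    inverses follows by induction on k; [smooth_C2] translates back to [partial]. *)
Fixpoint smooth k V f : Prop :=
  (forall w, V w -> {for w, continuous f}) /\
  if k is k'.+1 then exists g : 'I_n -> bool -> 'rV[R[i]]_n -> R,
    (forall j b w, V w -> line_derive f (real_dir j b) w (g j b w)) /\
    (forall j b, smooth k' V (g j b))
  else True.

Lemma smooth_continuous k V f : smooth k V f -> forall w, V w -> {for w, continuous f}.
Proof. by case: k => [|k] []. Qed.

Lemma smoothS k V f : smooth k.+1 V f -> smooth k V f.
Proof.
elim: k f => [|k IH] f [cf [g [fg sg]]]; first by split.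
by split=> //; exists g; split=> // j b; apply: IH; exact: sg.
Qed.

Lemma eq_smooth k V f g : open V -> (forall y, V y -> f y = g y) ->
  smooth k V f -> smooth k V g.
Proof.
move=> oV fg sf; have cg w : V w -> {for w, continuous g}.
  move=> Vw; apply: (near_eq_continuous (smooth_continuous sf Vw)).
  have : \forall y \near w, V y by exact: open_nbhs_nbhs.
  by apply: filterS.
case: k sf => [|k] sf; first by split.
case: sf => _ [df [dfP sdf]]; split=> //; exists df; split=> // j b w Vw.
exact: eq_line_derive oV Vw fg (dfP j b w Vw).
Qed.

Lemma smooth_cst k V (c : R) : smooth k V (fun=> c).
Proof.
have cc w : V w -> {for w, continuous (fun=> c : R)} by move=> _; exact: cst_continuous.
elim: k c cc => [|k IH] c cc; first by split.
split=> //; exists (fun _ _ _ => 0); split=> [j b w _|j b].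
  by apply: line_derive_affine => t; rewrite mulr0 addr0.
by apply: IH => w _; exact: cst_continuous.
Qed.

Lemma smoothD k V f g : smooth k V f -> smooth k V g ->
  smooth k V (fun y => f y + g y).
Proof.
elim: k f g => [|k IH] f g sf sg.
  split=> // w Vw.
  exact: (cvgD (smooth_continuous sf Vw) (smooth_continuous sg Vw)).
split=> [w Vw|].
  exact: (cvgD (smooth_continuous sf Vw) (smooth_continuous sg Vw)).
case: sf sg => [_ [df [dfP sdf]]] [_ [dg [dgP sdg]]].
exists (fun j b y => df j b y + dg j b y); split=> [j b w Vw|j b];
  last exact: (IH _ _ (sdf j b) (sdg j b)).
by apply: line_deriveD; [exact: dfP|exact: dgP].
Qed.

Lemma smoothM k V f g : smooth k V f -> smooth k V g ->
  smooth k V (fun y => f y * g y).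
Proof.
elim: k f g => [|k IH] f g sf sg.
  split=> // w Vw.
  exact: (cvgM (smooth_continuous sf Vw) (smooth_continuous sg Vw)).
split=> [w Vw|].
  exact: (cvgM (smooth_continuous sf Vw) (smooth_continuous sg Vw)).
have sf' := smoothS sf; have sg' := smoothS sg.
case: sf sg => [_ [df [dfP sdf]]] [_ [dg [dgP sdg]]].
exists (fun j b y => f y * dg j b y + g y * df j b y); split=> [j b w Vw|j b].
  by apply: line_deriveM; [exact: dfP|exact: dgP].
exact: (smoothD (IH _ _ sf' (sdg j b)) (IH _ _ sg' (sdf j b))).
Qed.

Lemma smoothV k V f : (forall w, V w -> f w != 0) -> smooth k V f ->
  smooth k V (fun y => (f y)^-1).
Proof.
move=> f0; elim: k => [|k IH] sf.
  by split=> // w Vw; exact: (cvgV (f0 w Vw) (smooth_continuous sf Vw)).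
split=> [w Vw|]; first exact: (cvgV (f0 w Vw) (smooth_continuous sf Vw)).
have sV := IH (smoothS sf).
case: sf => [_ [df [dfP sdf]]].
(* The derivative is written with products of inverses, to which the induction hypothesis and
   [smoothM] apply. *)
exists (fun j b y => -1 * ((f y)^-1 * (f y)^-1) * df j b y); split=> [j b w Vw|j b].
  have := line_deriveV (f0 w Vw) (dfP j b w Vw).
  by rewrite mulN1r -invfM -expr2.
exact: (smoothM (smoothM (smooth_cst _ _ _) (smoothM sV sV)) (sdf j b)).
Qed.

Lemma smooth_affine k V f (c : 'I_n -> bool -> R) : continuous f ->
  (forall j b w (t : R), f (w + t%:C *: real_dir j b) = f w + t * c j b) ->
  smooth k V f.
Proof.
move=> cf fE; have cf' w : V w -> {for w, continuous f} by move=> _; exact: cf.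
case: k => [|k]; split=> //.
exists (fun j b _ => c j b); split=> [j b w _|j b]; last exact: smooth_cst.
exact: line_derive_affine.
Qed.

Lemma smooth_C2 V f : open V -> smooth 2 V f -> C2_on V f.
Proof.
move=> oV [cf [g [gP sg]]].
have pE j b w : V w -> g j b w = partial f j b w.
  by move=> Vw; rewrite (partialE (gP j b w Vw)).
have C1 h : smooth 1 V h -> C1_on V h.
  move=> [ch [dh [dhP sdh]]] j b; split=> [w Vw|w Vw].
    by case: (dhP j b w Vw).
  have hE y : V y -> dh j b y = partial h j b y.
    by move=> Vy; rewrite (partialE (dhP j b y Vy)).
  exact: (smooth_continuous (@eq_smooth 0 V _ _ oV hE (sdh j b)) Vw).
split=> [|j b]; first by apply: C1; apply: smoothS; split=> //; exists g.
by apply: C1; exact: (@eq_smooth 1 V _ _ oV (pE j b) (sg j b)).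
Qed.

Lemma smooth_sum k V (I : eqType) (s : seq I) (F : I -> 'rV[R[i]]_n -> R) :
  (forall j, smooth k V (F j)) -> smooth k V (fun y => \sum_(j <- s) F j y).
Proof.
move=> sF; elim: s => [|j s IH].
  rewrite (_ : (fun y => _) = fun=> 0); first exact: smooth_cst.
  by apply/funext => y; rewrite big_nil.
rewrite (_ : (fun y => _) = fun y => F j y + \sum_(j <- s) F j y).
  exact: smoothD.
by apply/funext => y; rewrite big_cons.
Qed.

Lemma smooth_sqnorm_lin k V lam z (c : R[i]) :
  smooth k V (fun w => sqnorm (lin lam (w - z) - c)).
Proof.
have fE e w (t : R) : lin lam (w + t%:C *: e - z) - c =
    lin lam (w - z) - c + t%:C * lin lam e.
  by rewrite [w + _ - z]addrAC (linD lam (w - z)) linZ addrAC.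
have ReE (x y : R[i]) (t : R) : Re (x + t%:C * y) = Re x + t * Re y.
  by case: x y => [x1 x2] [y1 y2] /=; ring.
have ImE (x y : R[i]) (t : R) : Im (x + t%:C * y) = Im x + t * Im y.
  by case: x y => [x1 x2] [y1 y2] /=; ring.
have sRe : smooth k V (fun w => Re (lin lam (w - z) - c)).
  apply: (@smooth_affine _ _ _ (fun j b => Re (lin lam (real_dir j b)))) => [w|j b w t].
    exact: (@continuous_comp _ _ _ _ _ w (@lin_sub_continuous _ _ lam z c w)
      (@Re_continuous R _)).
  by rewrite fE ReE.
have sIm : smooth k V (fun w => Im (lin lam (w - z) - c)).
  apply: (@smooth_affine _ _ _ (fun j b => Im (lin lam (real_dir j b)))) => [w|j b w t].
    exact: (@continuous_comp _ _ _ _ _ w (@lin_sub_continuous _ _ lam z c w)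
      (@Im_continuous R _)).
  by rewrite fE ImE.
rewrite (_ : (fun w => _) = fun w => Re (lin lam (w - z) - c) * Re (lin lam (w - z) - c)
   + Im (lin lam (w - z) - c) * Im (lin lam (w - z) - c)).
  by apply: smoothD; apply: smoothM.
by apply/funext => w; rewrite /sqnorm !expr2.
Qed.

Lemma smooth_N2 k V z : smooth k V (fun w => N2 (w - z)).
Proof.
apply: smooth_sum => j.
rewrite (_ : (fun y => _) = fun w => sqnorm (lin (delta_mx j 0) (w - z) - 0)).
  exact: smooth_sqnorm_lin.
apply/funext => w; rewrite subr0 /lin [in RHS]mxE (bigD1 j) //= big1 ?addr0.
  by rewrite !mxE !eqxx mulr1.
by move=> k' kj; rewrite !mxE (negPf kj) mulr0.
Qed.

End Smooth.

(** * Second derivatives and Wirtinger derivatives *)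

Section LeviForm.
Context {R : realType} {n : nat}.
Implicit Types (f g : 'rV[R[i]]_n -> R) (w e X : 'rV[R[i]]_n) (lam : 'cV[R[i]]_n).

(** The real inner product Re(c conj(d)), in which derivatives of squared norms are expressed. *)
Definition rdot (c d : R[i]) : R := Re c * Re d + Im c * Im d.

Lemma dzbarE f k w : dzbar k (fun w => (f w)%:C) w =
  (2^-1 * partial f k false w) +i* (2^-1 * partial f k true w).
Proof.
have Im0 b : partial (fun w => Im (f w)%:C) k b w = 0.
  rewrite /partial derive1E; apply: (@derive_val _ _ _ _ _ _ 0).
  exact: is_derive_cst.
rewrite /dzbar /cpartial !Im0.
have -> : (2^-1 : R[i]) = (2^-1)%:C by rewrite fmorphV rmorph_nat.
rewrite -!/(partial f k _ w); move: (partial f k false w) (partial f k true w) (2^-1)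
  => p q h.
by apply/eqP; rewrite eq_complex /=; apply/andP; split; apply/eqP; ring.
Qed.

(** This is (1/4) (d/dx_j - i d/dy_j) (d/dx_k + i d/dy_k) split into real and imaginary parts, [Q]
    being the table of second real derivatives. *)
Lemma levi_mixed f (Q : 'I_n -> bool -> 'I_n -> bool -> R) z j k :
  (forall j b k c, line_derive (partial f k c) (real_dir j b) z (Q j b k c)) ->
  dz j (dzbar k (fun w => (f w)%:C)) z =
  (4^-1 * (Q j false k false + Q j true k true)) +i*
  (4^-1 * (Q j false k true - Q j true k false)).
Proof.
move=> dQ.
have -> : dzbar k (fun w => (f w)%:C) = fun w =>
    (2^-1 * partial f k false w) +i* (2^-1 * partial f k true w).
  by apply/funext => w; exact: dzbarE.
have pE b c : partial (fun w => 2^-1 * partial f k c w) j b z = 2^-1 * Q j b k c.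
  have l2 : line_derive (fun=> 2^-1) (real_dir j b) z (0 : R).
    by apply: line_derive_affine => t; rewrite mulr0 addr0.
  rewrite (partialE (line_deriveM l2 (dQ j b k c))).
  by rewrite mulr0 addr0.
set G := fun w => _.
have cpE b : cpartial G j b z = (2^-1 * Q j b k false) +i* (2^-1 * Q j b k true).
  exact: (f_equal2 (@Complex R) (pE b false) (pE b true)).
rewrite /dz !cpE.
have -> : (2^-1 : R[i]) = (2^-1)%:C by rewrite fmorphV rmorph_nat.
move: (Q _ _ _ _) (Q _ _ _ _) (Q _ _ _ _) (Q _ _ _ _) => a b c d.
by apply/eqP; rewrite eq_complex /=; apply/andP; split; apply/eqP; field.
Qed.

Lemma line_derive_eq f g e w d d' : line_derive f e w d -> f =1 g -> d = d' ->
  line_derive g e w d'.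
Proof. by move=> fd /funext <- <-. Qed.

Lemma line_derive_sqnorm (F : 'rV[R[i]]_n -> R[i]) e w (m : R[i]) :
  (forall t : R, F (w + t%:C *: e) = F w + t%:C * m) ->
  line_derive (fun y => sqnorm (F y)) e w (2 * rdot (F w) m).
Proof.
move=> Fm.
have lRe : line_derive (fun y => Re (F y)) e w (Re m).
  apply: line_derive_affine => t; rewrite Fm.
  by case: (F w) (m) => [a b] [c d] /=; ring.
have lIm : line_derive (fun y => Im (F y)) e w (Im m).
  apply: line_derive_affine => t; rewrite Fm.
  by case: (F w) (m) => [a b] [c d] /=; ring.
apply: (line_derive_eq (line_deriveD (line_deriveM lRe lRe) (line_deriveM lIm lIm))).
  by move=> y; rewrite /sqnorm !expr2.
by rewrite /rdot; ring.
Qed.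

Lemma lin_sub_line lam z (c : R[i]) w e (t : R) :
  lin lam (w + t%:C *: e - z) - c = (lin lam (w - z) - c) + t%:C * lin lam e.
Proof. by rewrite [w + _ - z]addrAC (linD lam (w - z)) linZ addrAC. Qed.

Lemma line_derive_rdot (F : 'rV[R[i]]_n -> R[i]) e w (m d : R[i]) :
  (forall t : R, F (w + t%:C *: e) = F w + t%:C * m) ->
  line_derive (fun y => rdot (F y) d) e w (rdot m d).
Proof.
move=> Fm; apply: line_derive_affine => t; rewrite Fm /rdot.
by case: (F w) (m) (d) => [a b] [a' b'] [a'' b''] /=; ring.
Qed.

Lemma line_derive_sum (I : eqType) (s : seq I) (F : I -> 'rV[R[i]]_n -> R) e w (d : I
  -> R) :
  (forall j, line_derive (F j) e w (d j)) ->
  line_derive (fun y => \sum_(j <- s) F j y) e w (\sum_(j <- s) d j).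
Proof.
move=> Fd; elim: s => [|j s IH].
  rewrite (_ : (fun y => _) = fun=> 0); last by apply/funext => y; rewrite big_nil.
  by rewrite big_nil; apply: line_derive_affine => t; rewrite mulr0 addr0.
rewrite big_cons (_ : (fun y => _) = fun y => F j y + \sum_(j <- s) F j y).
  exact: line_deriveD.
by apply/funext => y; rewrite big_cons.
Qed.

Definition rdotV X e : R := \sum_j rdot (X 0 j) (e 0 j).

Lemma line_derive_N2 z e w : line_derive (fun y => N2 (y - z)) e w (2 * rdotV (w - z) e).
Proof.
rewrite /rdotV mulr_sumr; apply: line_derive_sum => j.
by apply: (line_derive_sqnorm (F := fun y => (y - z) 0 j)) => t; rewrite !mxE addrAC.
Qed.

Lemma line_derive_rdotV z e e' w :
  line_derive (fun y => rdotV (y - z) e) e' w (rdotV e' e).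
Proof.
apply: line_derive_sum => j.
by apply: (line_derive_rdot (F := fun y => (y - z) 0 j)) => t; rewrite !mxE addrAC.
Qed.

(** [inner] with free constants; there c = 4 tau is the pole of f. *)
Definition model lam z (A k : R) (c : R[i]) w : R :=
  A * (sqnorm (lin lam (w - z)) / sqnorm (lin lam (w - z) - c)) + k * N2 (w - z).

Definition model_derive lam z (A k : R) (c : R[i]) e w : R :=
  let l := lin lam (w - z) in let m := lin lam e in let P := sqnorm (l - c) in
  A * (2 * rdot l m * P^-1 + sqnorm l * (- (P^-1 * P^-1) * (2 * rdot (l - c) m)))
  + k * (2 * rdotV (w - z) e).

Lemma line_derive_cst (a : R) e w : line_derive (fun=> a) e w 0.
Proof. by apply: line_derive_affine => t; rewrite mulr0 addr0. Qed.

Lemma line_derive_model lam z A k c e w : lin lam (w - z) - c != 0 ->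
  line_derive (model lam z A k c) e w (model_derive lam z A k c e w).
Proof.
move=> p0.
have p0' : sqnorm (lin lam (w - z) - c) != 0 by rewrite sqnorm_eq0.
have l1 : line_derive (fun y => sqnorm (lin lam (y - z))) e w
    (2 * rdot (lin lam (w - z)) (lin lam e)).
  apply: line_derive_sqnorm => t.
  by have := lin_sub_line lam z 0 w e t; rewrite !subr0.
have l2 := line_derive_sqnorm (F := fun y =>
  lin lam (y - z) - c) (lin_sub_line lam z c w e).
apply: (line_derive_eq (line_deriveD
  (line_deriveM (line_derive_cst A e w) (line_deriveM l1 (line_deriveV p0' l2)))
  (line_deriveM (line_derive_cst k e w) (line_derive_N2 z e w)))) => //.
by rewrite /model_derive /= -invfM -expr2; ring.
Qed.

(** The form l vanishes at z, so in the quotient |l|^2 / |l - c|^2 only the second derivative of the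
    numerator survives, divided by |c|^2. *)
Lemma line_derive_model2 lam z A k c e e' : c != 0 ->
  line_derive (model_derive lam z A k c e) e' z
    (2 * (A / sqnorm c * rdot (lin lam e') (lin lam e) + k * rdotV e' e)).
Proof.
move=> c0.
have l0 : lin lam (z - z) = 0 by rewrite subrr /lin mul0mx mxE.
have p0 : lin lam (z - z) - c != 0 by rewrite l0 sub0r oppr_eq0.
have p0' : sqnorm (lin lam (z - z) - c) != 0 by rewrite sqnorm_eq0.
have lE t : lin lam (z + t%:C *: e' - z) = lin lam (z - z) + t%:C * lin lam e'.
  by have := lin_sub_line lam z 0 z e' t; rewrite !subr0.
have l1 := line_derive_sqnorm (F := fun y => lin lam (y - z)) lE.
have l2 := line_deriveV p0' (line_derive_sqnorm (F := fun y =>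
  lin lam (y - z) - c) (lin_sub_line lam z c z e')).
have r1 := line_derive_rdot (F := fun y => lin lam (y - z)) (lin lam e) lE.
have r2 := line_derive_rdot (F := fun y =>
  lin lam (y - z) - c) (lin lam e) (lin_sub_line lam z c z e').
have C a := line_derive_cst a e' z.
apply: (line_derive_eq (line_deriveD
  (line_deriveM (C A) (line_deriveD (line_deriveM (line_deriveM (C 2) r1) l2)
     (line_deriveM l1 (line_deriveM (line_deriveM (C (-1)) (line_deriveM l2 l2))
       (line_deriveM (C 2) r2)))))
  (line_deriveM (C k) (line_deriveM (C 2) (line_derive_rdotV z e e' z))))).
  by move=> y; rewrite /model_derive /= mulN1r.
rewrite l0 sqnorm0.
have r0 x : rdot 0 x = 0 by rewrite /rdot /= !mul0r addr0.
by rewrite !r0 sub0r sqnormN /=; ring.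
Qed.

End LeviForm.

Section LeviModel.
Context {R : realType} {n : nat}.
Implicit Types (f g : 'rV[R[i]]_n -> R) (w e X z : 'rV[R[i]]_n) (lam : 'cV[R[i]]_n).

Lemma lin_real_dir lam j b :
  lin lam (real_dir j b : 'rV[R[i]]_n) = (if b then 'i else 1) * lam j 0.
Proof.
rewrite /real_dir linZ; congr (_ * _).
rewrite /lin mxE (bigD1 j) //= big1 ?addr0.
  by rewrite !mxE !eqxx mul1r.
by move=> k kj; rewrite !mxE (negPf kj) andbF mul0r.
Qed.

Lemma rdotV_real_dir (j k : 'I_n) b c :
  rdotV (real_dir j b) (real_dir k c) = ((j == k) && (b == c))%:R :> R.
Proof.
rewrite /rdotV (bigD1 j) //= big1 ?addr0.
  rewrite /real_dir !mxE !eqxx /=; have [_|_] := eqVneq j k.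
    by case: b c => [] [] /=; rewrite /rdot /=; ring.
  by rewrite mulr0 /rdot /= !mulr0 addr0.
move=> i ij; rewrite /real_dir !mxE (negPf ij) andbF mulr0 /rdot /=.
by rewrite !mul0r addr0.
Qed.

(** Since l(i e_j) = i l(e_j), the Wirtinger combination of the second derivatives is A / |c|^2
    lam_j conj(lam_k), plus k on the diagonal; summing against X gives the two squares. *)
Lemma levi_model f lam z (A k : R) (c : R[i]) (V : set 'rV[R[i]]_n) X :
  open V -> V z -> c != 0 -> (forall w, V w -> lin lam (w - z) - c != 0) ->
  (forall w, V w -> f w = model lam z A k c w) ->
  levi f z X = (A / sqnorm c * sqnorm (lin lam X) + k * N2 X)%:C.
Proof.
move=> oV Vz c0 pV fV.
pose Q j b k' c' := 2 * (A / sqnorm c * rdot (lin lam (real_dir j b)) (lin lam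
  (real_dir k' c'))
  + k * rdotV (real_dir j b : 'rV[R[i]]_n) (real_dir k' c')).
have pE k' c' w : V w ->
    model_derive lam z A k c (real_dir k' c') w = partial f k' c' w.
  move=> Vw; apply/esym/partialE.
  apply: (eq_line_derive oV Vw) (line_derive_model A k _ (pV w Vw)).
  by move=> y Vy; rewrite fV.
have dQ j b k' c' : line_derive (partial f k' c') (real_dir j b) z (Q j b k' c').
  by apply: (eq_line_derive oV Vz (pE k' c')); exact: line_derive_model2.
have dzE j k' : dz j (dzbar k' (fun w => (f w)%:C)) z =
    (A / sqnorm c)%:C * (lam j 0 * (lam k' 0)^*) + (k * (j == k')%:R)%:C.
  rewrite (levi_mixed j k' dQ) /Q !lin_real_dir !rdotV_real_dir !eqxx !andbT !andbF.
  move: (A / sqnorm c) (j == k') (lam j 0) (lam k' 0) => A' d [a1 a2] [b1 b2].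
  by apply/eqP; rewrite eq_complex /rdot /=; apply/andP; split; apply/eqP; field.
rewrite /levi.
under eq_bigr do under eq_bigr do rewrite dzE.
have -> : (A / sqnorm c * sqnorm (lin lam X) + k * N2 X)%:C =
    (A / sqnorm c)%:C * (lin lam X * (lin lam X)^*) + k%:C * dot X X.
  rewrite dotXX rmorphD !rmorphM; congr (_ * _ + _).
  case: (lin lam X) => a b; apply/eqP; rewrite eq_complex /sqnorm /=.
  by apply/andP; split; apply/eqP; ring.
have linE : lin lam X = \sum_j X 0 j * lam j 0 by rewrite /lin mxE.
rewrite /dot mulr_sumr linE rmorph_sum mulr_suml mulr_sumr -big_split.
apply: eq_bigr => j _ /=.
rewrite !mulr_sumr (bigD1 j) //= [in RHS](bigD1 j) //= eqxx mulr1.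
have e1 : \sum_(i | i != j) ((A / sqnorm c)%:C * (lam j 0 * (lam i 0)^*) +
     (k * (j == i)%:R)%:C) * X 0 j * (X 0 i)^* =
   \sum_(i | i != j) (A / sqnorm c)%:C * (X 0 j * lam j 0 * (X 0 i * lam i 0)^*).
  apply: eq_bigr => i ij; rewrite eq_sym (negPf ij) mulr0 rmorphM /=; ring.
rewrite e1 rmorphM /=; ring.
Qed.

Lemma smooth_model m lam z (A k : R) (c : R[i]) (V : set 'rV[R[i]]_n) :
  (forall w, V w -> lin lam (w - z) - c != 0) -> smooth m V (model lam z A k c).
Proof.
move=> pV; apply: smoothD; last by apply: smoothM; [exact: smooth_cst|exact: smooth_N2].
apply: smoothM; first exact: smooth_cst.
apply: smoothM; last first.
  apply: smoothV; last exact: smooth_sqnorm_lin.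
  by move=> w Vw; rewrite sqnorm_eq0 pV.
rewrite (_ : (fun w => _) = fun w => sqnorm (lin lam (w - z) - 0)).
  exact: smooth_sqnorm_lin.
by apply/funext => w; rewrite subr0.
Qed.

End LeviModel.

(** * The bound on the indicatrix given by the competitor *)

Section IndicatrixBound.
Context {R : realType} {n : nat}.

Lemma open_N2_ball (z : 'rV[R[i]]_n) (r : R) : open [set w | N2 (w - z) < r].
Proof.
rewrite openE => w /= wr; rewrite /interior.
exact: (cvgr_lt _ (@N2_sub_continuous R n z w) _ wr).
Qed.

(** On the indicatrix the Levi form of the competitor is less than 1; the conclusion is this
    inequality multiplied by 64 tau^2 rad^2. *)
Lemma indicatrix_sub (z : 'rV[R[i]]_n) (lam : 'cV[R[i]]_n) (tau rad rho : R)
    (D : set 'rV[R[i]]_n) :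
  0 < tau -> 0 < rho -> 2 * rho ^+ 2 <= rad ^+ 2 -> 0 < rad -> open D -> D z ->
  (forall w, D w -> N2 (w - z) < rad ^+ 2) ->
  (forall w, D w -> N2 (w - z) <= rho ^+ 2 -> Re (lin lam (w - z)) <= 2 * tau) ->
  forall X, indicatrix D z X ->
    rho ^+ 2 * sqnorm (lin lam X) + 16 * tau ^+ 2 * N2 X < 64 * tau ^+ 2 * rad ^+ 2.
Proof.
move=> tau0 rho0 rr rad0 oD Dz Drad Dslab X.
have rad2 : 0 < rad ^+ 2 by rewrite exprn_gt0.
have rho2 : 0 < rho ^+ 2 by rewrite exprn_gt0.
pose q : R := rho ^+ 2 / rad ^+ 2.
have q0 : 0 < q by rewrite divr_gt0.
have q2 : q <= 2^-1 by rewrite /q ler_pdivrMr //; lra.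
have lq : ln q < 0 by rewrite ln_lt0 // q0 (le_lt_trans q2) // invf_lt1 ?ltr1n.
(* The solution of q^sig = 1/2; it is at most 1 because q <= 1/2. *)
pose sig : R := ln 2^-1 / ln q.
have l2 : ln (2^-1 : R) < 0 by rewrite ln_lt0 // invr_gt0 ltr0n invf_lt1 ?ltr1n.
have sig01 : 0 < sig <= 1.
  rewrite /sig ler_ndivrMr // mul1r ler_ln ?posrE // q2 andbT.
  by rewrite nmulr_rgt0 // invr_lt0.
have sigE : q `^ sig = 2^-1.
  by rewrite /powR gt_eqF // /sig divfK ?lt_eqF // lnK // posrE.
have rlt : rho ^+ 2 < rad ^+ 2 by lra.
pose v := candidate z lam tau rad rho sig.
pose c : R[i] := (4 * tau)%:C.
have c0 : c != 0 by rewrite -sqnorm_eq0 sqnorm_real expf_neq0 // gt_eqF // mulr_gt0.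
have oz : N2 (z - z) = 0 by rewrite subrr N2_0.
have [r r0 rD] : exists2 r : R, 0 < r & forall w, N2 (w - z) < r -> D w.
  by apply/nbhs_N2P; exact: open_nbhs_nbhs.
(* If |w - z|^2 < rho^2 q, then [relsize] is below q^2 and its power of exponent sig is at most 1/4.
   So v2 <= |w - z|^2 / (4 rad^2) <= v1, and v1 is active on [V]. *)
pose s := Num.min r (Num.min (rho ^+ 2) (rho ^+ 2 * q)).
have s0 : 0 < s by rewrite !lt_min r0 rho2 mulr_gt0.
pose V := [set w | N2 (w - z) < s].
have oV : open V by exact: open_N2_ball.
have Vz : V z by rewrite /V /= oz.
have VD w : V w -> D w by rewrite /V /= lt_min => /andP[/rD].
have Vrho w : V w -> N2 (w - z) < rho ^+ 2 by rewrite /V /= !lt_min => /and3P[].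
have pV w : V w -> lin lam (w - z) - c != 0.
  by move=> Vw; apply: (pole_avoided tau0 Dslab (VD w Vw) (ltW (Vrho w Vw))).
have vV w : V w -> v w = model lam z (rho ^+ 2 / (4 * rad ^+ 2)) (4 * rad ^+ 2)^-1 c w.
  move=> Vw; rewrite /v /candidate Vrho // max_l //.
  have wq : relsize z rad w <= q ^+ 2.
    rewrite /relsize ler_pdivrMr // expr2 mulrAC [q * rad ^+ 2]divfK ?gt_eqF //.
    by move: Vw; rewrite /V /= !lt_min mulrC => /and3P[_ _ /ltW].
  have : relsize z rad w `^ sig <= 4^-1.
    have := @ge0_ler_powR R sig (ltW (proj1 (andP sig01))) (relsize z rad w) (q ^+ 2).
    rewrite !nnegrE relsize_ge0 // ?sqr_ge0 // => /(_ isT isT wq) /le_trans; apply.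
    rewrite -(powR_mulrn 2 (ltW q0)) powRAC powR_mulrn ?sigE ?powR_ge0 //.
    have -> : (2^-1 : R) ^+ 2 = 4^-1 by field.
    exact: lexx.
  move=> h; rewrite /inner /outer.
  apply: (@le_trans _ _ (relsize z rad w * 4^-1)).
    by rewrite ler_wpM2l // relsize_ge0.
  have -> : relsize z rad w * 4^-1 = (4 * rad ^+ 2)^-1 * N2 (w - z).
    by rewrite /relsize; field; rewrite gt_eqF.
  rewrite lerDr mulr_ge0 ?divr_ge0 ?sqnorm_ge0 ?(ltW rho2) //.
  by rewrite mulr_ge0 // ltW.
have sc : sibony_candidate D z v.
  split.
  - move=> w Dw; rewrite candidate_ge0 //=.
    exact: (candidate_lt1 tau0 rho0 rad0 sig01 Drad Dslab rlt Dw).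
  - rewrite vV // /model oz /lin subrr mul0mx mxE sqnorm0 mul0r !mulr0 addr0.
    by [].
  - apply: log_psh.
    + by move=> w; exact: candidate_ge0.
    + by move=> w Dw; exact: (candidate_lt1 tau0 rho0 rad0 sig01 Drad Dslab rlt Dw).
    + by move=> w Dw; exact: (candidate_continuous tau0 rho0 rad0 sig01 sigE oD Dslab Dw).
    + by move=> a b Da a0; exact: (candidate_log_submean tau0 rho0 rad0 sig01 Dslab b
      Da a0).
  - exists V; split=> //; apply: smooth_C2 => //.
    apply: (@eq_smooth _ _ 2 V _ _ oV (fun w Vw => esym (vV w Vw))).
    exact: smooth_model.
rewrite /indicatrix /= => X1.
have : ((Num.sqrt (Re (levi v z X)))%:E <= sibony D z X)%E.
  by apply: ereal_sup_ubound; exists v.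
move=> /le_lt_trans /(_ X1); rewrite lte_fin (levi_model X oV Vz c0 pV vV) /=.
rewrite -[X in _ < X]sqrtr1 ltr_sqrt // /c sqnorm_real => h.
have t0 : 0 < 64 * tau ^+ 2 * rad ^+ 2 by rewrite !mulr_gt0 ?exprn_gt0.
rewrite -(ltr_pM2l t0) mulr1 in h; apply: le_lt_trans h.
rewrite le_eqVlt; apply/orP; left; apply/eqP; field.
by rewrite !gt_eqF.
Qed.

End IndicatrixBound.

(** * Volume of thin slabs *)

Section Cover.
Context {R : realType} {n : nat}.
Implicit Types (X : 'rV[R[i]]_n.+1) (lam : 'cV[R[i]]_n.+1).

Lemma grid_cell (N : nat) (h y : R) : 0 < h -> (0 < N)%N -> 0 <= y <= N%:R * h ->
  exists k : 'I_N, k%:R * h <= y <= k%:R * h + h.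
Proof.
move=> h0 N0 /andP[y0 yN].
have yh0 : 0 <= y / h by rewrite divr_ge0 // ltW.
have [kN|Nk] := ltnP (Num.truncn (y / h)) N.
  exists (Ordinal kN) => /=; have /andP[k1 k2] := truncn_itv yh0.
  rewrite -ler_pdivlMr // k1 /= -[X in _ + X]mul1r -mulrDl natr1.
  by rewrite -ler_pdivrMr // ltW.
have N1 : (N.-1 < N)%N by rewrite prednK.
(* Only the right end y = N h gets here; it belongs to the last cell. *)
exists (Ordinal N1) => /=; rewrite -[X in _ && (_ <= _ + X)]mul1r -mulrDl natr1 prednK //.
rewrite yN andbT -ler_pdivlMr //.
have /andP[k1 _] := truncn_itv yh0; apply: le_trans k1.
by rewrite ler_nat (leq_trans (leq_pred _)).
Qed.

Lemma box_vol0 (a : 'rV[R[i]]_n.+1) : box_vol a a = 0.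
Proof. by rewrite /box_vol big_ord_recl /= !subrr mul0r mul0r. Qed.

(** The finite cover is continued to a sequence by degenerate boxes, of volume 0 because the
    dimension [n.+1] is positive. *)
Lemma volume_finite_cover (K : finType) (a b : K -> 'rV[R[i]]_n.+1) (v : R)
    (A : set 'rV[R[i]]_n.+1) :
  (forall k, box_le (a k) (b k)) -> (forall k, box_vol (a k) (b k) = v) ->
  (forall X, A X -> exists k, box (a k) (b k) X) ->
  (volume A <= (#|K|%:R * v)%:E)%E.
Proof.
move=> ab abv Acov.
pose F (c : K -> 'rV[R[i]]_n.+1) (m : nat) : 'rV[R[i]]_n.+1 :=
  if insub m is Some i then c (@enum_val K K i) else 0.
have Fvol m : box_vol (F a m) (F b m) = if (m < #|K|)%N then v else 0.
  rewrite /F; case: insubP => [i -> _|/negPf ->]; first exact: abv.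
  exact: box_vol0.
apply: ereal_inf_lbound; exists (F a, F b) => /=.
  split=> [m|X AX].
    rewrite /F; case: insubP => [i _ _|_]; first exact: ab.
    by move=> j; rewrite !mxE.
  have [k kX] := Acov X AX; exists (enum_rank k : nat) => //=.
  by rewrite /F valK /= enum_rankK.
apply: cvg_lim => //; apply: cvg_near_cst; near=> m.
have Km : (#|K| <= m)%N by near: m; exact: nbhs_infty_ge.
rewrite (big_cat_nat (leq0n _) Km) /=.
have -> : (\sum_(#|K| <= i < m) (box_vol (F a i) (F b i))%:E = 0)%E.
  rewrite big_nat_cond big1 // => i /andP[/andP[Ki _] _].
  by rewrite Fvol ltnNge Ki.
rewrite adde0.
rewrite sumEFin big_nat_cond (eq_bigr (fun=> v)); last first.
  by move=> i /andP[/andP[_ iK] _]; rewrite Fvol iK.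
by rewrite -big_nat_cond sumr_const_nat subn0 mulr_natl.
Unshelve. all: by end_near.
Qed.

(** Solving for the coordinate j0: lam_j0 (X_j0 - Y_j0) = l(X) - l(Z), where Z is X - Y with
    coordinate j0 erased. Both terms on the right are O(h). *)
Lemma slab_cell lam (j0 : 'I_n.+1) : lam j0 0 != 0 ->
  exists2 C : R, 0 < C & forall (h : R) (X Y : 'rV[R[i]]_n.+1), 0 < h ->
    lin lam Y = 0 -> sqnorm (lin lam X) <= h ^+ 2 ->
    (forall i, i != j0 -> sqnorm (X 0 i - Y 0 i) <= 2 * h ^+ 2) ->
    sqnorm (X 0 j0 - Y 0 j0) <= (C * h) ^+ 2.
Proof.
move=> l0; have [C1 C10 lC1] := sqnorm_lin_le lam.
pose K := 2 * (1 + C1 * (2 * n.+1%:R)) / sqnorm (lam j0 0).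
have sl0 : 0 < sqnorm (lam j0 0) by rewrite lt_neqAle eq_sym sqnorm_eq0 l0 sqnorm_ge0.
have K0 : 0 < K by rewrite divr_gt0 // mulr_gt0 // addr_gt0 // mulr_gt0 // mulr_gt0.
exists (K + 1); first by rewrite addr_gt0.
move=> h X Y h0 Y0 Xh XY.
pose Z := X - Y - (X 0 j0 - Y 0 j0) *: delta_mx 0 j0.
have h2 : 0 < h ^+ 2 by rewrite exprn_gt0.
have N2Z : N2 Z <= (2 * n.+1%:R) * h ^+ 2.
  apply: (@le_trans _ _ (\sum_(i < n.+1) 2 * h ^+ 2)); last first.
    by rewrite sumr_const card_ord -[leLHS]mulr_natr; nra.
  apply: ler_sum => i _; rewrite /Z !mxE.
  have [->|ij] := eqVneq i j0.
    by rewrite mulr1 subrr sqnorm0 mulr_ge0 // ltW.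
  by rewrite mulr0 subr0 XY.
have linZ' : lam j0 0 * (X 0 j0 - Y 0 j0) = lin lam X - lin lam Z.
  have ld : lin lam (delta_mx 0 j0) = lam j0 0.
    rewrite /lin mxE (bigD1 j0) //= big1 ?addr0; first by rewrite !mxE !eqxx mul1r.
    by move=> k kj; rewrite !mxE (negPf kj) andbF mul0r.
  by rewrite /Z !linB linZ ld Y0; ring.
have : sqnorm (lam j0 0) * sqnorm (X 0 j0 - Y 0 j0) <= K * sqnorm (lam j0 0) * h ^+ 2.
  rewrite -sqnormM linZ' (le_trans (sqnormD_le _ _)) // sqnormN.
  rewrite /K divfK ?gt_eqF //.
  have := lC1 Z; have : C1 * N2 Z <= C1 * ((2 * n.+1%:R) * h ^+ 2) by rewrite ler_pM2l.
  by move: Xh; lra.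
rewrite [K * _]mulrC -mulrA ler_pM2l // => /le_trans; apply.
by rewrite exprMn ler_pM2r //; nra.
Qed.

(** Grid the n coordinates other than j0 with step h = 2T / N. Over each of the N^(2n) cells the
    remaining coordinate lies in a square of side 2 C h, so the total volume is (2T)^(2n) 4 C^2 h^2
    = B h^2. The slab width is h itself. *)
Lemma slab_volume lam (T e : R) : lam != 0 -> 0 < T -> 0 < e ->
  exists2 d : R, 0 < d &
    (volume [set X | sqnorm (lin lam X) <= d ^+ 2 /\ N2 X <= T ^+ 2]%R <= e%:E)%E.
Proof.
move=> lam0 T0 e0.
have [j0 l0] : exists j0, lam j0 0 != 0.
  apply: contra_notP (elimN eqP lam0) => no; apply/matrixP => i j.
  by rewrite ord1 mxE; apply/eqP; apply: contra_notT no => h; exists i.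
have [C C0 cell] := slab_cell l0.
pose B := (2 * T) ^+ (n * 2) * (4 * C ^+ 2).
have B0 : 0 < B by rewrite !mulr_gt0 // ?exprn_gt0 // ?mulr_gt0.
(* This forces h (1 + B / e) <= 1, hence h <= 1 and B h <= e, hence B h^2 <= e. *)
pose N := (Num.truncn (2 * T * (1 + B / e))).+1.
have N0 : 0 < N%:R :> R by rewrite ltr0n.
pose h : R := 2 * T / N%:R.
have h0 : 0 < h by rewrite divr_gt0 // mulr_gt0.
have Nh : N%:R * h = 2 * T by rewrite mulrC divfK ?gt_eqF.
have hB : B * h ^+ 2 <= e.
  have hN : h * (1 + B / e) <= 1.
    by rewrite /h mulrAC ler_pdivrMr // mul1r ltW // truncnS_gt.
  have Be : 0 < B / e by rewrite divr_gt0.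
  have h1 : h * (B / e) <= 1 by nra.
  have h2 : h <= 1 by nra.
  have : B * h <= e by move: h1; rewrite mulrA ler_pdivrMr // mul1r mulrC.
  by move=> h3; rewrite expr2 mulrA; nra.
exists h => //.
pose K := {ffun 'I_n * bool -> 'I_N}.
pose cr (k : K) (i : 'I_n) : R[i] :=
  (- T + (k (i, false))%:R * h) +i* (- T + (k (i, true))%:R * h).
(* The value of coordinate j0 that puts the grid corner on the hyperplane l = 0. *)
pose c0 (k : K) : R[i] := - (\sum_i cr k i * lam (lift j0 i) 0) / lam j0 0.
pose ctr (k : K) : 'rV[R[i]]_n.+1 :=
  \row_j (if unlift j0 j is Some i then cr k i else c0 k).
pose lo (k : K) : 'rV[R[i]]_n.+1 :=
  \row_j (if unlift j0 j is Some i then cr k i else c0 k - ((C * h) +i* (C * h))).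
pose hi (k : K) : 'rV[R[i]]_n.+1 :=
  \row_j (if unlift j0 j is Some i then cr k i + (h +i* h) else c0 k + ((C * h) +i* (C
    * h))).
have ctr0 k : lin lam (ctr k) = 0.
  rewrite /lin mxE (bigD1_ord j0) //= mxE unlift_none /c0 divfK //.
  under eq_bigr do rewrite mxE liftK.
  by rewrite addNr.
have Ch : 0 < C * h by rewrite mulr_gt0.
apply: le_trans (@volume_finite_cover K lo hi (4 * (C * h) ^+ 2 * (h ^+ 2) ^+ n) _ _ _
  _) _.
- move=> k j; rewrite !mxE; case: (unlift j0 j) => [i|].
    by case: (cr k i) => x y /=; rewrite !lerDl ltW.
  by case: (c0 k) => x y /=; lra.
- move=> k; rewrite /box_vol (bigD1_ord j0) //= !mxE unlift_none.
  congr (_ * _).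
    by case: (c0 k) => x y /=; ring.
  under eq_bigr do rewrite !mxE liftK.
  rewrite (eq_bigr (fun=> h ^+ 2)); last first.
    by move=> i _; case: (cr k i) => x y /=; ring.
  by rewrite prodr_const card_ord.
- move=> X [Xh XT].
  have Tb (j : 'I_n.+1) : [/\ 0 <= Re (X 0 j) + T <= N%:R * h & 0 <= Im (X 0 j) + T <=
    N%:R * h].
    have := le_trans (le_N2 X j) XT; rewrite Nh /sqnorm; case: (X 0 j) => x y /= xy.
    have xT : `|x| <= T.
      by rewrite -(@ler_pXn2r _ 2) ?nnegrE ?(ltW T0) // real_normK ?num_real //;
        have := sqr_ge0 y; lra.
    have yT : `|y| <= T.
      by rewrite -(@ler_pXn2r _ 2) ?nnegrE ?(ltW T0) // real_normK ?num_real //;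
        have := sqr_ge0 x; lra.
    move: xT yT; rewrite !ler_norml => /andP[x1 x2] /andP[y1 y2].
    by split; apply/andP; split; lra.
  have [k kP] : exists k : K, forall ib : 'I_n * bool,
      let y := (if ib.2 then Im (X 0 (lift j0 ib.1)) else Re (X 0 (lift j0 ib.1))) + T in
      (k ib)%:R * h <= y <= (k ib)%:R * h + h.
    have ex (ib : 'I_n * bool) : exists k : 'I_N, 
      let y := (if ib.2 then Im (X 0 (lift j0 ib.1)) else Re (X 0 (lift j0 ib.1))) + T in
      k%:R * h <= y <= k%:R * h + h.
      by case: ib => i [] /=; apply: grid_cell => //; have [] := Tb (lift j0 i).
    have [k kP] := fin_all_exists ex; exists (finfun k) => ib.
    by rewrite ffunE; exact: kP.
  have kre i := kP (i, false); have kim i := kP (i, true).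
  exists k.
  have cb : sqnorm (X 0 j0 - ctr k 0 j0) <= (C * h) ^+ 2.
    apply: (cell h X (ctr k)) => // j; rewrite mxE.
    case: unliftP => [i -> _|->]; last by rewrite eqxx.
    have := kre i; have := kim i; rewrite /= /cr; case: (X 0 (lift j0 i)) => x y /=.
    rewrite /sqnorm /=; move: (_ * h) (_ * h) => p q /andP[p1 p2] /andP[q1 q2].
    nra.
  have c0b : - (C * h) <= Re (X 0 j0) - Re (c0 k) <= C * h /\
             - (C * h) <= Im (X 0 j0) - Im (c0 k) <= C * h.
    move: cb; rewrite mxE unlift_none; case: (X 0 j0) (c0 k) => [x y] [x' y'] /=.
    rewrite /sqnorm /= -!ler_norml => cb; split;
      rewrite -(@ler_pXn2r _ 2) ?nnegrE ?(ltW Ch) // real_normK ?num_real //.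
      by have := sqr_ge0 (y - y'); lra.
    by have := sqr_ge0 (x - x'); lra.
  split=> j; rewrite !mxE; case: unliftP => [i ->|->].
  + have := kre i; have := kim i; rewrite /= /cr; case: (X 0 (lift j0 i)) => x y /=.
    by move=> /andP[? ?] /andP[? ?]; split; lra.
  + move: c0b; case: (X 0 j0) (c0 k) => [x y] [x' y'] /=.
    by move=> [/andP[? ?] /andP[? ?]]; split; lra.
  + have := kre i; have := kim i; rewrite /= /cr; case: (X 0 (lift j0 i)) => x y /=.
    by move=> /andP[? ?] /andP[? ?]; split; lra.
  + move: c0b; case: (X 0 j0) (c0 k) => [x y] [x' y'] /=.
    by move=> [/andP[? ?] /andP[? ?]]; split; lra.
rewrite lee_fin; apply: le_trans hB.
rewrite card_ffun card_ord card_prod card_ord card_bool natrX.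
rewrite le_eqVlt; apply/orP; left; apply/eqP.
have -> : (h ^+ 2) ^+ n = h ^+ (n * 2) by rewrite -exprM mulnC.
by rewrite /B -Nh [(_ * h) ^+ (n * 2)]exprMn; ring.
Qed.

End Cover.

(** * The boundary near p *)

Section C1Estimate.
Context {R : realType} {n : nat}.
Implicit Types (phi : 'rV[R[i]]_n -> R) (w e y P : 'rV[R[i]]_n) (d : 'I_n * bool).

Definition rcoord d w : R := if d.2 then Im (w 0 d.1) else Re (w 0 d.1).

Lemma rcoord_line d d' y (t : R) :
  rcoord d (y + t%:C *: real_dir d'.1 d'.2) = rcoord d y + t * (d == d')%:R.
Proof.
case: d d' => [j b] [j' b']; rewrite /rcoord /real_dir !mxE xpair_eqE /=.
case: (y 0 j) => p q; case: (j == j'); last by case: b b' => [] [] /=; ring.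
by case: b b' => [] [] /=; ring.
Qed.

Lemma rcoord_inj w y : (forall d, rcoord d w = rcoord d y) -> w = y.
Proof.
move=> wy; apply/rowP => j; have := wy (j, false); have := wy (j, true).
by rewrite /rcoord /=; case: (w 0 j) (y 0 j) => [a b] [c d] /= -> ->.
Qed.

Lemma sqr_rcoord_le d w : rcoord d w ^+ 2 <= N2 w.
Proof.
apply: le_trans (le_N2 w d.1); rewrite /rcoord /sqnorm.
by case: ifP => _; rewrite ?lerDl ?lerDr sqr_ge0.
Qed.

Lemma rcoordB d w y : rcoord d (w - y) = rcoord d w - rcoord d y.
Proof. by rewrite /rcoord !mxE; case: (w _ _) (y _ _) => [a b] [a' b'] /=; case: ifP. Qed.

(** The two conditions on t say that t lies between 0 and c, whatever the sign of c. *)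
Lemma mean_value_bound (g dg : R -> R) (c D eps : R) :
  (forall t : R, `|t| <= `|c| -> 0 <= t * c -> is_derive t 1 g (dg t) /\ `|dg t - D|
    <= eps) ->
  `|g c - g 0 - D * c| <= eps * `|c|.
Proof.
move=> gP.
have mvt (a b : R) : a <= b -> (forall t : R, a <= t <= b -> is_derive t 1 g (dg t)) ->
    exists2 t, a <= t <= b & g b - g a = dg t * (b - a).
  move=> ab dgt.
  have [t||t] := @MVT_segment R g dg a b ab.
  - by rewrite in_itv /= => /andP[t1 t2]; apply: dgt; rewrite !ltW.
  - apply: derivable_within_continuous => t; rewrite in_itv /= => tab.
    by have [] := dgt t tab.
  - by rewrite in_itv /= => tab E; exists t.
have [c0|c0] := leP 0 c.
  have bnd (t : R) : 0 <= t <= c -> is_derive t 1 g (dg t) /\ `|dg t - D| <= eps.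
    move=> /andP[t0 tc]; apply: gP; first by rewrite !ger0_norm.
    exact: mulr_ge0.
  have [t tc ->] := mvt 0 c c0 (fun t tc => (bnd t tc).1).
  by rewrite subr0 -mulrBl normrM ler_wpM2r // (bnd t tc).2.
have bnd (t : R) : c <= t <= 0 -> is_derive t 1 g (dg t) /\ `|dg t - D| <= eps.
  move=> /andP[ct t0]; apply: gP; first by rewrite (ler0_norm t0) (ltr0_norm c0) lerN2.
  exact: mulr_le0 t0 (ltW c0).
have [t tc E] := mvt c 0 (ltW c0) (fun t tc => (bnd t tc).1).
have -> : g c - g 0 - D * c = (dg t - D) * c.
  by rewrite -[g c - g 0]opprB E; ring.
by rewrite normrM ler_wpM2r // (bnd t tc).2.
Qed.

Lemma line_derive_shift phi e y (t d : R) : line_derive phi e (y + t%:C *: e) d ->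
  is_derive t (1 : R) (on_real_line phi e y) d.
Proof.
move=> hd.
have -> : on_real_line phi e y = on_real_line phi e (y + t%:C *: e) \o (fun x => x - t).
  apply/funext => x; rewrite /on_real_line /= -addrA -scalerDl -rmorphD /=.
  by rewrite subrKC.
have hs : is_derive t (1 : R) (fun x : R => x - t) 1.
  by apply: is_derive_eq; rewrite subr0.
rewrite -[d]mulr1; apply: is_derive1_comp.
by rewrite subrr.
Qed.

(** Walk from y to w by changing one real coordinate at a time, [l] listing those still to be
    changed. Each segment stays in the cube around P, where the mean value theorem costs at most eps
    times its length. *)
Lemma path_estimate phi P (r eps : R) (l : seq ('I_n * bool)) y w :
  (forall x d, (forall d', `|rcoord d' x - rcoord d' P| < r) ->
     line_derive phi (real_dir d.1 d.2) x (partial phi d.1 d.2 x) /\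
     `|partial phi d.1 d.2 x - partial phi d.1 d.2 P| <= eps) ->
  uniq l ->
  (forall d, `|rcoord d y - rcoord d P| < r) -> (forall d, `|rcoord d w - rcoord d P|
    < r) ->
  (forall d, d \notin l -> rcoord d w = rcoord d y) ->
  `|phi w - phi y - \sum_(d <- l) partial phi d.1 d.2 P * (rcoord d w - rcoord d y)|
    <= eps * \sum_(d <- l) `|rcoord d w - rcoord d y|.
Proof.
move=> phiP; elim: l y => [|d l IH] y.
  move=> _ yr wr wy; rewrite !big_nil (@rcoord_inj w y) ?subrr ?mulr0 ?normr0 //.
  by move=> d; exact: wy.
rewrite /= => /andP[dl ul] yr wr wy.
pose c := rcoord d w - rcoord d y.
pose y' := y + c%:C *: real_dir d.1 d.2.
have y'E d' : rcoord d' y' = if d' == d then rcoord d w else rcoord d' y.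
  rewrite rcoord_line; case: eqP => [->|_]; last by rewrite mulr0 addr0.
  by rewrite mulr1 /c addrC subrK.
have seg (t : R) : `|t| <= `|c| -> 0 <= t * c ->
    forall d', `|rcoord d' (y + t%:C *: real_dir d.1 d.2) - rcoord d' P| < r.
  move=> tc tc0 d'; rewrite rcoord_line; case: eqP => [->|_]; last first.
    by rewrite mulr0 addr0.
  have := yr d; have := wr d; rewrite mulr1 !ltr_norml => /andP[? ?] /andP[? ?].
  have tc' : 0 <= t <= c \/ c <= t <= 0.
    have [c0|c0] := leP 0 c.
      left; rewrite (ger0_norm c0) ler_norml in tc; case/andP: tc => ct ->.
      rewrite andbT; have [c1|c1] := eqVneq c 0; first by rewrite c1 oppr0 in ct.
      by rewrite -(@pmulr_lge0 _ c) // lt_neqAle eq_sym c1.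
    right; rewrite (ltr0_norm c0) ler_norml opprK in tc; case/andP: tc => -> ct.
    by rewrite -(@nmulr_lge0 _ c).
  by rewrite /c in tc'; case: tc' => /andP[? ?]; apply/andP; split; lra.
have y'r d' : `|rcoord d' y' - rcoord d' P| < r.
  by rewrite y'E; case: eqP => [->|_]; [exact: wr|exact: yr].
have wy' d' : d' \notin l -> rcoord d' w = rcoord d' y'.
  move=> d'l; rewrite y'E; case: eqP => [->//|/eqP d'd].
  by apply: wy; rewrite inE negb_or d'd.
have eq_l (j : 'I_n * bool) : j \in l -> rcoord j y' = rcoord j y.
  by move=> jl; rewrite y'E; case: eqP => // jd; rewrite jd (negPf dl) in jl.
have h1 := IH y' ul y'r wr wy'.
have h2 : `|phi y' - phi y - partial phi d.1 d.2 P * c| <= eps * `|c|.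
  rewrite -[phi y](on_real_line0 phi (real_dir d.1 d.2)).
  apply: (@mean_value_bound (on_real_line phi (real_dir d.1 d.2) y)
    (fun t => partial phi d.1 d.2 (y + t%:C *: real_dir d.1 d.2))) => t tc tc0.
  have [p1 p2] := phiP _ d (seg t tc tc0).
  exact: (conj (line_derive_shift p1) p2).
rewrite !big_cons.
have e1 : \sum_(j <- l) partial phi j.1 j.2 P * (rcoord j w - rcoord j y') =
    \sum_(j <- l) partial phi j.1 j.2 P * (rcoord j w - rcoord j y).
  by apply: eq_big_seq => j jl; rewrite eq_l.
have e2 : \sum_(j <- l) `|rcoord j w - rcoord j y'| = \sum_(j <- l) `|rcoord j w -
  rcoord j y|.
  by apply: eq_big_seq => j jl; rewrite eq_l.
rewrite e1 e2 in h1.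
set S := \sum_(j <- l) _ * _ in h1 *; set T := \sum_(j <- l) _ in h1 *.
have -> : phi w - phi y - (partial phi d.1 d.2 P * c + S) =
   (phi w - phi y' - S) + (phi y' - phi y - partial phi d.1 d.2 P * c) by ring.
apply: le_trans (ler_normD _ _) _.
by rewrite [leRHS]mulrDr [leRHS]addrC; exact: lerD.
Qed.

(** Strict differentiability: the differential at the single point P serves all pairs w, y close to
    P. *)
Lemma C1_estimate phi V P (eps : R) : open V -> V P -> C1_on V phi -> 0 < eps ->
  exists2 r : R, 0 < r & forall w y (rho : R), N2 (w - P) < r ^+ 2 -> N2 (y - P) < r
    ^+ 2 ->
    N2 (w - y) <= rho ^+ 2 -> 0 <= rho ->
    `|phi w - phi y - \sum_j \sum_b partial phi j b P * rcoord (j, b) (w - y)| <= eps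
      * rho.
Proof.
move=> oV VP C1phi eps0.
pose M : R := (size (index_enum ('I_n * bool)%type)).+1%:R.
have M0 : 0 < M by rewrite ltr0n.
have e'0 : 0 < eps / M by rewrite divr_gt0.
have : \forall x \near P, V x /\
    forall d, `|partial phi d.1 d.2 x - partial phi d.1 d.2 P| <= eps / M.
  have near_d d : \forall x \near P,
      `|partial phi d.1 d.2 x - partial phi d.1 d.2 P| <= eps / M.
    have c := (C1phi d.1 d.2).2 P VP.
    have /cvgr_dist_le /(_ _ e'0) := c.
    by apply: filterS => x; rewrite distrC.
  have VP' : \forall x \near P, V x by exact: open_nbhs_nbhs.
  near=> x; split; first by near: x.
  near: x; exact: filter_forall near_d.
move=> /nbhs_N2P[q q0 qP].
(* As r <= 1, a point of the cube of half-side r has squared distance at most 2 n r to P, less than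
   (2n + 1) r <= q. *)
pose m : R := (n.*2.+1)%:R.
have m0 : 0 < m by rewrite ltr0n.
pose r := Num.min 1 (q / m).
have r0 : 0 < r by rewrite lt_min ltr01 divr_gt0.
have box x : (forall d', `|rcoord d' x - rcoord d' P| < r) -> N2 (x - P) < q.
  move=> xr; have sq j : sqnorm ((x - P) 0 j) <= 2 * r.
    have := xr (j, false); have := xr (j, true); rewrite -!rcoordB /rcoord /=.
    case: ((x - P) 0 j) => a b /=; rewrite /sqnorm /= -(real_normK (num_real a))
      -(real_normK (num_real b)).
    have r1 : r <= 1 by rewrite ge_min lexx.
    by have := normr_ge0 a; have := normr_ge0 b; nra.
  apply: (@le_lt_trans _ _ (\sum_(j < n) 2 * r)); first exact: ler_sum.
  rewrite sumr_const card_ord -[ltLHS]mulr_natr.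
  have rq : r * m <= q by rewrite -ler_pdivlMr // ge_min lexx orbT.
  apply: lt_le_trans rq; rewrite mulrAC -natrM mulrC ltr_pM2l // ltr_nat.
  by rewrite ltnS mul2n.
exists r => // w y rho wP yP wy rho0.
have bx x : N2 (x - P) < r ^+ 2 -> forall d, `|rcoord d x - rcoord d P| < r.
  move=> xP d; rewrite -rcoordB -(@ltr_pXn2r _ 2) ?nnegrE ?(ltW r0) // real_normK
    ?num_real //.
  exact: le_lt_trans (sqr_rcoord_le _ _) xP.
have := @path_estimate phi P r (eps / M) (index_enum ('I_n * bool)%type) y w _ _ (bx y
  yP) (bx w wP).
rewrite index_enum_uniq.
have h1 x d : (forall d', `|rcoord d' x - rcoord d' P| < r) ->
     line_derive phi (real_dir d.1 d.2) x (partial phi d.1 d.2 x) /\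
     `|partial phi d.1 d.2 x - partial phi d.1 d.2 P| <= eps / M.
  move=> xr; have [Vx px] := qP _ (box x xr); apply: (conj _ (px d)).
  apply: DeriveDef; first exact: ((C1phi d.1 d.2).1 x Vx).
  by rewrite /partial derive1E.
move=> /(_ h1 isT) h2.
rewrite pair_big /=.
have -> : \sum_p partial phi p.1 p.2 P * rcoord (p.1, p.2) (w - y) =
  \sum_d partial phi d.1 d.2 P * (rcoord d w - rcoord d y).
  by apply: eq_bigr => d _; rewrite rcoordB; case: d.
have sum_le : \sum_(d : 'I_n * bool) `|rcoord d w - rcoord d y| <= M * rho.
  apply: (@le_trans _ _ (\sum_(d : 'I_n * bool) rho)).
    apply: ler_sum => d _; rewrite -rcoordB -(@ler_pXn2r _ 2) ?nnegrE // real_normK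
      ?num_real //.
    exact: le_trans (sqr_rcoord_le _ _) wy.
  rewrite big_const_seq count_predT iter_addr_0 -[leLHS]mulr_natl ler_wpM2r //.
  by rewrite ler_nat.
have dn d : d \notin index_enum ('I_n * bool)%type -> rcoord d w = rcoord d y.
  by rewrite mem_index_enum.
apply: le_trans (h2 dn) _.
apply: le_trans (ler_wpM2l (ltW e'0) sum_le) _.
by rewrite mulrA divfK // gt_eqF.
Unshelve. all: by end_near.
Qed.

End C1Estimate.

(** * Unitary invariance, bounded sets, monotonicity of the volume *)

Section Assembly.
Context {R : realType} {n : nat}.

Lemma N2_unitary (U : 'M[R[i]]_n) (X : 'rV[R[i]]_n) : U \is unitarymx -> N2 (X *m U) =
  N2 X.
Proof.
move=> /unitarymxP UU.
have N2E (Y : 'rV[R[i]]_n) : (N2 Y)%:C = (Y *m (map_mx Num.conj Y^T)) 0 0.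
  by rewrite -dotXX /dot mxE; apply: eq_bigr => j _; rewrite !mxE.
apply: (@complexI R); rewrite !N2E trmx_mul map_mxM /= mulmxA -[X *m U *m _]mulmxA.
by rewrite UU mulmx1.
Qed.

Lemma bounded_N2 (D : set 'rV[R[i]]_n) : bounded_set D ->
  exists2 rad : R, 0 < rad & forall w z, D w -> D z -> N2 (w - z) < rad ^+ 2.
Proof.
move=> [M [Mreal MD]].
have ME : M = (Re M)%:C by rewrite RRe_real.
(* Boundedness gives a bound by every real number above M, here |Re M| + 1; a further 1 makes the
   ball inequality strict. *)
pose B : R := `|Re M| + 2.
have B0 : 0 < B by rewrite ltr_wpDl.
have DB w : D w -> forall j, sqnorm (w 0 j) <= B ^+ 2.
  move=> Dw j.
  have : M < (`|Re M| + 1)%:C by rewrite ME ltcR /= ltr_pwDr // ler_norm.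
  move=> /MD /(_ w Dw) /= wM.
  have : ball (0 : 'rV[R[i]]_n) B%:C w.
    rewrite -ball_normE /= sub0r normrN; apply: le_lt_trans wM _.
    by rewrite ltcR /B ltrD2l ltr1n.
  move=> [_ /(_ 0 j)]; rewrite -ball_normE /= mxE sub0r normrN sqnorm_norm ltcR => h.
  rewrite -[sqnorm _]sqr_sqrtr ?sqnorm_ge0 //.
  by rewrite ler_pXn2r ?nnegrE ?sqrtr_ge0 ?ltW.
have N2B w : D w -> N2 w <= n%:R * B ^+ 2.
  move=> Dw; apply: (@le_trans _ _ (\sum_(j < n) B ^+ 2)).
    by apply: ler_sum => j _; exact: DB.
  by rewrite sumr_const card_ord mulr_natl.
exists (2 * (n%:R + 1) * B); first by rewrite !mulr_gt0 // ltr_wpDl.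
move=> w z Dw Dz; apply: le_lt_trans (N2D_le _ _) _; rewrite N2N.
have := N2B _ Dw; have := N2B _ Dz; have : 0 < B ^+ 2 by rewrite exprn_gt0.
have : 0 <= n%:R :> R by [].
by rewrite exprMn; move: (B ^+ 2) (n%:R : R) => b m; nra.
Qed.

Lemma volume_ge0 (A : set 'rV[R[i]]_n) : (0 <= volume A)%E.
Proof.
apply: le_ereal_inf_tmp => _ [[a b] /= [ab _] <-].
apply: nneseries_ge0 => k _ _; rewrite lee_fin; apply: prodr_ge0 => j _.
by have [r i] := ab k j; rewrite mulr_ge0 // subr_ge0.
Qed.

Lemma le_volume (A B : set 'rV[R[i]]_n) : A `<=` B -> (volume A <= volume B)%E.
Proof.
move=> AB; apply: ereal_inf_le_tmp => _ [ab [abl abB] <-].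
by exists ab => //; split=> //; exact: subset_trans AB abB.
Qed.

Lemma cvge0P (T : Type) (F : set_system T) {FF : Filter F} (f : T -> \bar R) :
  (forall x, 0 <= f x)%E ->
  (forall e : R, 0 < e -> \forall x \near F, (f x <= e%:E)%E) ->
  f x @[x --> F] --> (0%R)%:E.
Proof.
move=> f0 fe; apply/fine_cvgP; split.
  have := fe 1 ltr01; apply: filterS => x fx.
  by rewrite ge0_fin_numE // (le_lt_trans fx) // ltry.
apply/cvgrPdist_le => e e0; have := fe e e0; apply: filterS => x fx.
rewrite sub0r normrN ger0_norm ?fine_ge0 // -lee_fin fineK //.
by rewrite ge0_fin_numE // (le_lt_trans fx) // ltry.
Qed.

End Assembly.

Section Gradient.
Context {R : realType} {n : nat}.
Implicit Types (phi : 'rV[R[i]]_n.+1 -> R).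

(* The complex linear form whose real part is Re w_0 minus the differential of
   [phi] at [P]. *)
Definition normal_form phi P : 'cV[R[i]]_n.+1 :=
  \col_j (((j == 0)%:R - partial phi j false P) +i* partial phi j true P).

Lemma Re_normal_form phi P X : Re (lin (normal_form phi P) X) =
  Re (X 0 0) - \sum_j \sum_b partial phi j b P * rcoord (j, b) X.
Proof.
have -> : Re (X 0 0) = \sum_j (j == 0)%:R * Re (X 0 j).
  rewrite (bigD1 0) //= mul1r big1 ?addr0 // => j j0.
  by rewrite (negPf j0) mul0r.
rewrite /lin mxE (raddf_sum (@complex.Re R)) -sumrB; apply: eq_bigr => j _.
rewrite big_bool mxE /rcoord; move: (partial _ _ _ _) (partial _ _ _ _) => u v.
by case: (X 0 j) => a b /=; ring.
Qed.

(** The graph function does not depend on Re w_0, so the coefficient of w_0 has real part 1. *)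
Lemma normal_form_neq0 (phi : R -> 'rV[R[i]]_n -> R) P :
  normal_form (fun w => phi (Im (w 0 0)) (col' 0 w)) P != 0.
Proof.
set f := fun w => _.
have p0 : partial f 0 false P = 0.
  apply: partialE; apply: line_derive_affine => t; rewrite mulr0 addr0 /f.
  rewrite /real_dir scale1r; congr phi.
    by rewrite !mxE eqxx; case: (P 0 0) => a b /=; ring.
  by apply/matrixP => i j; rewrite !mxE andbF mulr0 addr0.
apply/eqP => /matrixP /(_ 0 0); rewrite !mxE eqxx p0 subr0 => /eqP.
by rewrite eq_complex /= oner_eq0.
Qed.

End Gradient.

Theorem proposition3 (R : realType) (n : nat)
    (D : set 'rV[R[i]]_n.+1) (p : 'rV[R[i]]_n.+1)
    (domD : domain D) (bndD : bounded_set D)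
    (pD : frontier D p) (C1D : C1_boundary_near D p) :
  sibony_volume D z @[z --> within D (nbhs p)] --> (0%R)%:E.
Proof.
have [oD _ _] := domD.
have [U [b [phi [V]]]] := C1D; set f := fun w => _; set P := p *m U + b.
move=> [unitU [oV VP] C1f DV].
have [rad rad0 Drad] := bounded_N2 bndD.
pose lam0 := normal_form f P; pose lam := U *m lam0.
have linE X : lin lam X = lin lam0 (X *m U) by rewrite /lin /lam mulmxA.
have lam0' : lam != 0.
  apply: contraNneq (normal_form_neq0 phi P) => l0.
  by rewrite -[normal_form _ _](mulKmx (unitarymx_unit unitU)) -/lam0 -/lam l0 mulmx0.
(* A frontier point of the open set D is not in D, so p does not lie below the graph. *)
have fP : f P <= Re (P 0 0).
  rewrite leNgt; apply/negP => fP.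
  have Dp : D p by apply/(DV p VP).
  by case: pD => _; apply; rewrite /interior; exact: open_nbhs_nbhs.
apply: cvge0P => [z|e e0]; first exact: volume_ge0.
(* With tau = eps rho, [indicatrix_sub] will give |X| < 2 rad and |l(X)| < 8 rad eps. This dictates
   the radius 2 rad and eps = d / (8 rad). *)
have T0 : 0 < 2 * rad by rewrite mulr_gt0.
have [d d0 slab] := slab_volume lam0' T0 e0.
pose eps := d / (8 * rad).
have eps0 : 0 < eps by rewrite divr_gt0 // mulr_gt0.
have [r r0 est] := C1_estimate oV VP C1f eps0.
have [q q0 qV] : exists2 q : R, 0 < q & forall w, N2 (w - P) < q -> V w.
  by apply/nbhs_N2P; exact: open_nbhs_nbhs.
have [C C0 lC] := sqnorm_lin_le lam0.
pose s := Num.min 1 (Num.min (r ^+ 2) q).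
have s0 : 0 < s by rewrite !lt_min ltr01 exprn_gt0.
have s1 : s <= 1 by rewrite ge_min lexx.
(* The bound rad / 2 gives 2 rho^2 <= rad^2; the bound s / 4, here and in [kap], keeps the ball of
   radius rho around z inside the neighbourhood |w - p|^2 < s. *)
pose rho0 := Num.min (rad / 2) (s / 4).
have rho00 : 0 < rho0 by rewrite lt_min !divr_gt0.
(* The second bound makes (eps + C + 1) kap <= eps rho0, which dominates tau. *)
pose kap := Num.min (s / 4) (eps * rho0 / (eps + (C + 1))).
have ec0 : 0 < eps + (C + 1) by rewrite addr_gt0 // addr_gt0.
have kap0 : 0 < kap by rewrite lt_min (divr_gt0 s0) //= divr_gt0 // mulr_gt0.
have sV x : N2 (x - P) < s -> [/\ V x, N2 (x - P) < r ^+ 2 & N2 (x - P) < q].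
  by rewrite !lt_min => /and3P[_ xr xq]; split=> //; exact: qV.
have img w z : (w - z) *m U = (w *m U + b) - (z *m U + b).
  by rewrite mulmxBl opprD addrACA subrr addr0.
have imgP w : N2 (w *m U + b - P) = N2 (w - p) by rewrite /P -img N2_unitary.
have ReB (A B : 'rV[R[i]]_n.+1) : Re ((A - B) 0 0) = Re (A 0 0) - Re (B 0 0).
  by rewrite !mxE; case: (A 0 0) (B 0 0) => [? ?] [? ?].
apply/nbhs_N2P; exists (kap ^+ 2); first by rewrite exprn_gt0.
move=> z zp Dz.
have kap2 : kap ^+ 2 <= s / 4.
  have ks : kap <= s / 4 by rewrite ge_min lexx.
  by have := kap0; nra.
pose W := z *m U + b.
have WP : N2 (W - P) < s by rewrite imgP; apply: lt_le_trans zp _; lra.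
have [VW Wr _] := sV W WP.
pose tau := f W - Re (W 0 0).
have tau0 : 0 < tau by rewrite subr_gt0; exact/(DV z VW).
(* Since f P <= Re P_0, the estimate between W and P gives tau <= - Re l(W - P) + eps kap. *)
have tau_lt : tau <= eps * rho0.
  have Pr : N2 (P - P) < r ^+ 2 by rewrite subrr N2_0 exprn_gt0.
  have Wk : N2 (W - P) <= kap ^+ 2 by rewrite imgP ltW.
  have := est W P kap Wr Pr Wk (ltW kap0).
  rewrite ler_norml => /andP[_ h1].
  have := Re_normal_form f P (W - P); rewrite -/lam0 ReB => h2.
  have h3 : - Re (lin lam0 (W - P)) <= (C + 1) * kap.
    have sk : sqnorm (lin lam0 (W - P)) <= ((C + 1) * kap) ^+ 2.
      apply: le_trans (lC _) _; apply: le_trans (ler_wpM2l (ltW C0) Wk) _.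
      by rewrite exprMn ler_pM2r ?exprn_gt0 //; nra.
    have Ck : 0 <= (C + 1) * kap by rewrite mulr_ge0 ?(ltW kap0) // addr_ge0 ?ltW.
    rewrite -raddfN; apply: le_trans (Re_le_sqrt _) _.
    by rewrite sqnormN -[leRHS](ger0_norm Ck) -sqrtr_sqr ler_sqrt ?sqr_ge0.
  have h4 : (eps + (C + 1)) * kap <= eps * rho0.
    by rewrite mulrC -ler_pdivlMr // ge_min lexx orbT.
  by rewrite /tau; move: h1 h2 h3 h4 fP; lra.
pose rho := tau / eps.
have rhoE : eps * rho = tau by rewrite mulrC divfK ?gt_eqF.
have rhopos : 0 < rho by rewrite divr_gt0.
have rho_le : rho <= rho0 by rewrite ler_pdivrMr // mulrC.
have rho_rad : rho <= rad / 2 by rewrite (le_trans rho_le) // ge_min lexx.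
have rho_s : rho <= s / 4 by rewrite (le_trans rho_le) // ge_min lexx orbT.
(* Re l(W' - W) is Re W'_0 - Re W_0 minus the differential of f at P. Since Re W'_0 < f W', it is
   less than tau + eps rho = 2 tau. *)
have slope w : D w -> N2 (w - z) <= rho ^+ 2 -> Re (lin lam (w - z)) <= 2 * tau.
  move=> Dw wz; pose W' := w *m U + b.
  have W'P : N2 (W' - P) < s.
    rewrite imgP (_ : w - p = (w - z) + (z - p)); last by rewrite addrA subrK.
    apply: le_lt_trans (N2D_le _ _) _.
    have : rho ^+ 2 <= s / 4 by nra.
    by move: wz zp kap2; lra.
  have [VW' W'r _] := sV W' W'P.
  have W'W : N2 (W' - W) <= rho ^+ 2 by rewrite -img N2_unitary.
  have := est W' W rho W'r Wr W'W (ltW rhopos).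
  rewrite rhoE ler_norml => /andP[_ h1].
  have h2 : Re (W' 0 0) < f W' by apply/(DV w VW').
  rewrite linE img Re_normal_form ReB.
  by move: h1 h2; rewrite /tau; lra.
apply: le_trans _ slab; apply: le_volume => X XD.
have rr : 2 * rho ^+ 2 <= rad ^+ 2 by nra.
have := indicatrix_sub tau0 rhopos rr rad0 oD Dz (fun w Dw => Drad w z Dw Dz) slope XD.
have epsd : 8 * rad * eps = d by rewrite mulrC divfK // gt_eqF // mulr_gt0.
have rho2 : 0 < rho ^+ 2 by rewrite exprn_gt0.
have l0 := sqnorm_ge0 (lin lam X); have X0 := N2_ge0 X.
rewrite -rhoE => h; split.
  rewrite -(ler_pM2l rho2) -epsd; have : 0 <= 16 * (eps * rho) ^+ 2 * N2 X.
    exact: mulr_ge0 (mulr_ge0 (ler0n _ 16) (sqr_ge0 _)) X0.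
  by move: h; lra.
have e2 : 0 < 16 * (eps * rho) ^+ 2 by rewrite mulr_gt0 // exprn_gt0 // mulr_gt0.
rewrite -(ler_pM2l e2); have : 0 <= rho ^+ 2 * sqnorm (lin lam X).
  exact: mulr_ge0 (ltW rho2) l0.
by move: h; lra.
Qed.
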